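(* Let $M$ be a compact Riemannian manifold without boundary of dimension $n$ with non-negative Ricci curvature. Let $m>0$, $m\ne1$, satisfy $m-1+\frac2n>0$, and let $U$ be a smooth function on $M$ satisfying $$\Delta U\ge\frac{k_3}{2m}$$ for a constant $k_3$. Then any smooth positive solution $\rho_t$ of the equation $$\dot\rho_t=\Delta(\rho_t^m)+U\rho_t^{2-m}$$ satisfies, for every $t>0$ (in the time interval on which the solution is defined), $$\frac{2m}{1-m}\,\Delta(\rho_t^{m-1})\le\frac{2n}{2+n(m-1)}\,a_{\frac{k_3(2+n(m-1))}{2n}}(t),$$ where $$a_K(t)=\begin{cases}\sqrt K\cot(\sqrt K\,t)&\text{if }K>0,\\ \frac1t&\text{if }K=0,\\ \sqrt{-K}\coth(\sqrt{-K}\,t)&\text{if }K<0.\end{cases}$$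
   Context: $\Delta$ is the Laplace-Beltrami operator ($\Delta=\mathrm{div}\,\nabla$); the solution is defined for times starting at $0$ and a dot denotes the derivative in $t$. *)

(* Defs.v *)
From HB Require Import structures.
From mathcomp Require Import all_boot all_order all_algebra.
From mathcomp Require Import all_classical all_reals all_analysis.
Import Order.TTheory GRing.Theory Num.Theory.
Import numFieldNormedType.Exports.

Set Implicit Arguments.
Unset Strict Implicit.
Unset Printing Implicit Defensive.

Local Open Scope classical_set_scope.
Local Open Scope ring_scope.

(* Used for [V] finite-dimensional and [A] open, where it is C^infinity
   regularity on [A]: all iterated directional derivatives exist and are
   continuous on [A]. *)
Definition smooth_on (R : realType) (V W : normedModType R)
    (A : set V) (f : V -> W) : Prop :=
  forall vs : seq V, let Df : V -> W := foldr (fun v h => 'D_v h) f vs in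
  forall x, A x -> {for x, continuous Df} /\ forall v, derivable Df x v.

(* Smoothness on an arbitrary subset: local extendability to a smooth function
   on an open set. *)
Definition smooth_within (R : realType) (V W : normedModType R)
    (A : set V) (f : V -> W) : Prop :=
  forall x, A x -> exists O : set V, exists F : V -> W,
    [/\ open O, O x, smooth_on O F & forall y, O y -> A y -> F y = f y].

Record chart (R : realType) (n : nat) (M : topologicalType) := Chart {
  chart_dom : set M;
  chart_map : M -> 'rV[R]_n;
  chart_inv : 'rV[R]_n -> M;
  chart_dom_open : open chart_dom;
  chart_cod_open : open (chart_map @` chart_dom);
  chart_mapK : forall x, chart_dom x -> chart_inv (chart_map x) = x;
  chart_map_continuous :
    forall x, chart_dom x -> {for x, continuous chart_map};
  chart_inv_continuous :
    forall y, (chart_map @` chart_dom) y -> {for y, continuous chart_inv}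
}.

Definition chart_cod (R : realType) (n : nat) (M : topologicalType)
    (c : chart R n M) : set 'rV[R]_n :=
  chart_map c @` chart_dom c.

Definition transition_dom (R : realType) (n : nat) (M : topologicalType)
    (c c' : chart R n M) : set 'rV[R]_n :=
  chart_map c @` (chart_dom c `&` chart_dom c').

Definition transition (R : realType) (n : nat) (M : topologicalType)
    (c c' : chart R n M) : 'rV[R]_n -> 'rV[R]_n :=
  chart_map c' \o chart_inv c.

(* The metric is given by its component matrices [metric c] in each chart [c]
   of the atlas. Tangent vectors in coordinates are row vectors; [metric_change]
   says that the components are those of one covariant 2-tensor field. *)
Record riemannianManifold (R : realType) (n : nat) := RiemannianManifold {
  carrier :> topologicalType;
  carrier_hausdorff : hausdorff_space carrier;
  carrier_second_countable : @second_countable carrier;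
  atlas : set (chart R n carrier);
  atlas_cover : forall x, exists2 c, atlas c & chart_dom c x;
  atlas_smooth : forall c c', atlas c -> atlas c' ->
    smooth_on (transition_dom c c') (transition c c');
  metric : chart R n carrier -> 'rV[R]_n -> 'M[R]_n;
  metric_smooth : forall c, atlas c -> smooth_on (chart_cod c) (metric c);
  metric_sym : forall c y, atlas c -> chart_cod c y ->
    (metric c y)^T = metric c y;
  metric_pos : forall c y (v : 'rV[R]_n), atlas c -> chart_cod c y ->
    v != 0 -> 0 < (v *m metric c y *m v^T) 0 0;
  metric_change : forall c c' y (v w : 'rV[R]_n), atlas c -> atlas c' ->
    transition_dom c c' y ->
    v *m metric c y *m w^T =
    'D_v (transition c c') y *m metric c' (transition c c' y)
      *m ('D_w (transition c c') y)^T
}.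

Section LocalGeometry.
Variables (R : realType) (n : nat).
Implicit Types (G : 'rV[R]_n -> 'M[R]_n) (f : 'rV[R]_n -> R).

Definition partial (i : 'I_n) f : 'rV[R]_n -> R := 'D_(delta_mx 0 i) f.

(* [christoffel G k i j] is Gamma^k_ij. *)
Definition christoffel G (k i j : 'I_n) (y : 'rV[R]_n) : R :=
  2^-1 * \sum_(l < n) invmx (G y) k l *
    (partial i (fun z => G z j l) y + partial j (fun z => G z i l) y
     - partial l (fun z => G z i j) y).

(* [riemann G l k i j] is R^l_kij, i.e.
   R(d_i, d_j) d_k = \sum_l R^l_kij d_l with
   R(X, Y) Z = nabla_X nabla_Y Z - nabla_Y nabla_X Z - nabla_[X, Y] Z. *)
Definition riemann G (l k i j : 'I_n) (y : 'rV[R]_n) : R :=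
  partial i (christoffel G l j k) y - partial j (christoffel G l i k) y
  + \sum_(p < n) (christoffel G l i p y * christoffel G p j k y
                  - christoffel G l j p y * christoffel G p i k y).

(* Ric(Y, Z) is the trace of X |-> R(X, Y) Z; round spheres have Ric > 0. *)
Definition ricci G (y : 'rV[R]_n) : 'M[R]_n :=
  \matrix_(j, k) \sum_(i < n) riemann G i k i j y.

Definition gradient G f (y : 'rV[R]_n) : 'rV[R]_n :=
  \row_i \sum_(j < n) invmx (G y) i j * partial j f y.

(* The trace of the covariant derivative nabla X. *)
Definition divergence G (X : 'rV[R]_n -> 'rV[R]_n) (y : 'rV[R]_n) : R :=
  \sum_(i < n) (partial i (fun z => X z 0 i) y
                + \sum_(j < n) christoffel G i i j y * X y 0 j).

Definition local_laplacian G f : 'rV[R]_n -> R := divergence G (gradient G f).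

End LocalGeometry.

Section Manifold.
Variables (R : realType) (n : nat) (M : riemannianManifold R n).

Definition nonnegative_ricci : Prop :=
  forall (c : chart R n M) (y v : 'rV[R]_n), atlas c -> chart_cod c y ->
    0 <= (v *m ricci (metric c) y *m v^T) 0 0.

Definition smooth_function (f : M -> R) : Prop :=
  forall c : chart R n M, atlas c -> smooth_on (chart_cod c) (f \o chart_inv c).

Definition chart_at (x : M) : chart R n M := sval (cid2 (atlas_cover x)).

(* The value does not depend on the chart around [x] used to compute it. *)
Definition laplacian (f : M -> R) (x : M) : R :=
  let c := chart_at x in
  local_laplacian (metric c) (f \o chart_inv c) (chart_map c x).

(* Joint smoothness of (t, x) |-> rho t x on J x M, up to the end points of J
   that belong to J. *)
Definition smooth_evolution (J : set R) (rho : R -> M -> R) : Prop :=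
  forall c : chart R n M, atlas c ->
    smooth_within (J `*` chart_cod c : set (R * 'rV[R]_n)%type)
      (fun p => rho p.1 (chart_inv c p.2)).

(* rho' = Delta (rho ^ m) + U rho ^ (2 - m) on J x M, where the time derivative
   is one-sided at the end points of J that belong to J. *)
Definition solves_equation (J : set R) (m : R) (U : M -> R)
    (rho : R -> M -> R) : Prop :=
  forall t x, J t ->
    (s - t)^-1 * (rho s x - rho t x) @[s --> within J t^'] -->
    laplacian (fun y => rho t y `^ m) x + U x * rho t x `^ (2 - m).

End Manifold.

Arguments nonnegative_ricci {R n} M.

Definition cotangent (R : realType) (x : R) : R := cos x / sin x.

Definition hyperbolic_cotangent (R : realType) (x : R) : R :=
  (expR x + expR (- x)) / (expR x - expR (- x)).

Definition comparison_fun (R : realType) (K t : R) : R :=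
  if 0 < K then Num.sqrt K * cotangent (Num.sqrt K * t)
  else if K == 0 then t^-1
  else Num.sqrt (- K) * hyperbolic_cotangent (Num.sqrt (- K) * t).

(* Main.v *)
(* The pressure v = m/(m-1) rho^(m-1) satisfies
     v' = (m-1) v Lap v + |grad v|^2 + m U.
   Taking the Laplacian and using Bochner's formula, Ric >= 0 and the trace
   inequality (Lap v)^2 <= n |Hess v|^2, one finds, wherever L = Lap v attains its
   minimum over M at a fixed time,
     L' >= beta L^2 + k3/2,   beta = m - 1 + 2/n.
   At a maximum point of U, k3/(2m) <= Lap U <= 0, so K = k3 beta/2 <= 0 and
   a_K = C/S for a pair S' = C, C' = -K S, S(0) = 0, C(0) = 1 that is positive for
   positive times.  Let H = S (-2L) - (2/beta) C on [0,t] x M.  If H had a positive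
   maximum, it would be attained at a positive time, where the differential
   inequality gives H' <= beta L H < 0 (L is negative there), against H' >= 0.
   Multiplying by S removes the singularity of a_K at time 0.

   The tensor calculus is carried out in an arbitrary commutative ring with n
   commuting derivations, and then applied to the ring of functions smooth on an
   open set of coordinates. *)
Require Import Defs.
From HB Require Import structures.
From mathcomp Require Import all_boot all_order all_algebra ring lra.
From mathcomp Require Import all_classical all_reals all_analysis.
Set Implicit Arguments.
Unset Strict Implicit.
Unset Printing Implicit Defensive.
Import Order.TTheory GRing.Theory Num.Theory.
Import numFieldNormedType.Exports.
Local Open Scope classical_set_scope.
Local Open Scope ring_scope.

(** * Riemannian geometry over a ring with commuting derivations *)

(** Two obstacles shape the development. Pointwise calculus needs a differentiability side condition
    at every rewriting; in a ring of smooth functions derivatives are total operations, so Bochner's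
    formula and the pressure equation become identities settled by reindexing sums and by [ring].
    Moreover [laplacian] is evaluated in a chart chosen point by point, with no regularity in the
    point: neither the continuity of L, needed for H to attain a maximum, nor a comparison of L at
    neighbouring points is accessible before the Laplacian is known to be invariant under changes of
    coordinates. The constants come from a Riccati equation. With w = -2L the inequality reads w' <=
    -(beta/2) w^2 - k3, and w = (2/beta) a turns the case of equality into a' = -K - a^2 with K = k3
    beta/2, which a_K = C/S solves. In beta, the part m - 1 comes from the Laplacian of the factor
    (m-1) v, and 2/n from the trace inequality. *)

(* [g] is the metric, [h] its inverse and [half] the element 1/2; the instance of
   interest is the ring of smooth functions on an open set of coordinates. *)
Record metricData (A : comNzRingType) (n : nat) (d : 'I_n -> A -> A)
    (g h : 'M[A]_n) (half : A) : Prop := MetricData {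
  md_D : forall i a b, d i (a + b) = d i a + d i b;
  md_M : forall i a b, d i (a * b) = d i a * b + a * d i b;
  md_C : forall i j a, d i (d j a) = d j (d i a);
  md_gT : g^T = g;
  md_hg : h *m g = 1%:M;
  md_half : half + half = 1
}.

Section MetricAlgebra.
Variables (A : comNzRingType) (n : nat) (d : 'I_n -> A -> A).
Variables (g h : 'M[A]_n) (half : A).

Definition ag_christoffel (k i j : 'I_n) : A :=
  half * \sum_(l < n) h k l * (d i (g j l) + d j (g i l) - d l (g i j)).

Definition ag_grad (u : A) (k : 'I_n) : A := \sum_(j < n) h k j * d j u.

(* [ag_cov X k j] is the component nabla_j X^k. *)
Definition ag_cov (X : 'I_n -> A) (k j : 'I_n) : A :=
  d j (X k) + \sum_(l < n) ag_christoffel k j l * X l.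

Definition ag_lap (u : A) : A := \sum_(k < n) ag_cov (ag_grad u) k k.

Definition ag_hess (u : A) (i j : 'I_n) : A :=
  d i (d j u) - \sum_(p < n) ag_christoffel p i j * d p u.

Definition ag_ricci (j k : 'I_n) : A :=
  \sum_(i < n) (d i (ag_christoffel i j k) - d j (ag_christoffel i i k)
  + \sum_(p < n) (ag_christoffel i i p * ag_christoffel p j k
                  - ag_christoffel i j p * ag_christoffel p i k)).

Definition ag_form (a b : A) : A := \sum_(k < n) ag_grad a k * d k b.

Hypothesis md : metricData d g h half.
Notation Gam := ag_christoffel.

Lemma ag_d0 i : d i 0 = 0.
Proof. by apply: (addrI (d i 0)); rewrite -(md_D md) !addr0. Qed.

Lemma ag_dN i a : d i (- a) = - d i a.
Proof. by apply: (addrI (d i a)); rewrite -(md_D md) !subrr ag_d0. Qed.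

Lemma ag_dB i a b : d i (a - b) = d i a - d i b.
Proof. by rewrite (md_D md) ag_dN. Qed.

Lemma ag_d_sum i (I : Type) (r : seq I) (P : pred I) (F : I -> A) :
  d i (\sum_(j <- r | P j) F j) = \sum_(j <- r | P j) d i (F j).
Proof. by apply: (big_morph (d i) (md_D md i) (ag_d0 i)). Qed.

Lemma ag_gC i j : g i j = g j i.
Proof. by rewrite -{1}(md_gT md) mxE. Qed.

Lemma ag_gh : g *m h = 1%:M.
Proof. exact: (mulmx1C (md_hg md)). Qed.

Lemma ag_hC i j : h i j = h j i.
Proof.
suff hT : h^T = h by rewrite -{1}hT mxE.
have : g *m h^T = 1%:M by rewrite -{1}(md_gT md) -trmx_mul (md_hg md) trmx1.
by move=> /(congr1 (mulmx h)); rewrite mulmxA (md_hg md) mul1mx mulmx1.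
Qed.

Lemma ag_sum_delta (F : 'I_n -> A) i : \sum_j (i == j)%:R * F j = F i.
Proof.
rewrite (bigD1 i) //= eqxx mul1r big1 ?addr0 // => j /negPf ji.
by rewrite eq_sym ji mul0r.
Qed.

Lemma ag_lower_h (i k : 'I_n) : \sum_j g i j * h j k = (i == k)%:R.
Proof. by have := congr1 (fun M : 'M[A]_n => M i k) ag_gh; rewrite !mxE. Qed.

Lemma ag_raise_g (i k : 'I_n) : \sum_j h i j * g j k = (i == k)%:R.
Proof. by have := congr1 (fun M : 'M[A]_n => M i k) (md_hg md); rewrite !mxE. Qed.

Lemma ag_christoffelC k i j : Gam k i j = Gam k j i.
Proof.
by congr (_ * _); apply: eq_bigr => l _; rewrite (ag_gC i j) [d i _ + _]addrC.
Qed.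

(** Contraction with [g] cancels [h]; the right-hand side is the Christoffel symbol of the first
    kind. *)
Lemma ag_christoffel_lower l i j :
  \sum_k g l k * Gam k i j =
  half * (d i (g j l) + d j (g i l) - d l (g i j)).
Proof.
under [in LHS]eq_bigr => k _ do rewrite mulrCA mulr_sumr.
rewrite -mulr_sumr exchange_big /=; congr (_ * _).
transitivity (\sum_p (l == p)%:R * (d i (g j p) + d j (g i p) - d p (g i j))).
  by apply: eq_bigr => p _; rewrite -ag_lower_h mulr_suml; under [in LHS]eq_bigr do rewrite mulrA.
exact: ag_sum_delta.
Qed.

(** This is nabla g = 0. In the sum of the two symbols of the first kind all derivatives cancel
    except [d i (g j l)], which occurs twice and is halved. *)
Lemma ag_metric_compat i j l :
  d i (g j l) = \sum_k g l k * Gam k i j + \sum_k g j k * Gam k i l.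
Proof.
rewrite !ag_christoffel_lower -mulrDr (ag_gC l j) -[LHS]mul1r -(md_half md).
ring.
Qed.

Lemma ag_grad_lower u j : \sum_k g j k * ag_grad u k = d j u.
Proof.
under [in LHS]eq_bigr => k _ do rewrite mulr_sumr.
rewrite exchange_big /= -[RHS](ag_sum_delta (fun p => d p u)).
by apply: eq_bigr => p _; rewrite -ag_lower_h mulr_suml; under [in LHS]eq_bigr do rewrite mulrA.
Qed.

Lemma ag_hessC u i j : ag_hess u i j = ag_hess u j i.
Proof.
rewrite /ag_hess (md_C md); congr (_ - _).
by apply: eq_bigr => p _; rewrite ag_christoffelC.
Qed.

(** Metric compatibility lets the lowering of an index pass through the covariant derivative. *)
Lemma ag_hess_lower u l j :
  \sum_k g l k * ag_cov (ag_grad u) k j = ag_hess u j l.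
Proof.
rewrite /ag_hess -(ag_grad_lower u l) ag_d_sum.
under [X in X - _]eq_bigr => k _ do rewrite (md_M md) ag_metric_compat addrC.
rewrite big_split /= /ag_cov.
under [in LHS]eq_bigr => k _ do rewrite mulrDr.
rewrite big_split /= -addrA; congr (_ + _).
under [X in X - _]eq_bigr => k _ do rewrite mulrDl.
rewrite big_split /= addrAC.
have -> : \sum_i (\sum_p g i p * Gam p j l) * ag_grad u i =
   \sum_p Gam p j l * d p u.
  under [in LHS]eq_bigr => i _ do rewrite mulr_suml.
  rewrite exchange_big /=; apply: eq_bigr => p _.
  rewrite -ag_grad_lower mulr_sumr; apply: eq_bigr => i _.
  by rewrite (ag_gC i p); ring.
rewrite subrr add0r.
under [in LHS]eq_bigr => i _ do rewrite mulr_sumr.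
rewrite exchange_big /=; apply: eq_bigr => i _; rewrite mulr_suml.
by apply: eq_bigr => p _; ring.
Qed.

Lemma ag_cov_grad u k j :
  ag_cov (ag_grad u) k j = \sum_l h k l * ag_hess u j l.
Proof.
under [in RHS]eq_bigr => l _ do rewrite -ag_hess_lower mulr_sumr.
rewrite exchange_big /= -[LHS](ag_sum_delta (fun p => ag_cov (ag_grad u) p j)).
by apply: eq_bigr => p _; rewrite -ag_raise_g mulr_suml; under [in RHS]eq_bigr do rewrite mulrA.
Qed.

Lemma ag_lapE u : ag_lap u = \sum_k \sum_l h k l * ag_hess u k l.
Proof. by apply: eq_bigr => k _; rewrite ag_cov_grad. Qed.

Lemma ag_formC a b : ag_form a b = ag_form b a.
Proof.
rewrite /ag_form /ag_grad.
under [in LHS]eq_bigr => k _ do rewrite mulr_suml.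
under [RHS]eq_bigr => k _ do rewrite mulr_suml.
rewrite exchange_big; apply: eq_bigr => i _; apply: eq_bigr => k _ /=.
by rewrite (ag_hC k i); ring.
Qed.

(** The Christoffel terms that complete [d j (ag_grad b k)] to a covariant derivative are exactly
    those that complete the second derivatives of [f] to its Hessian. *)
Lemma ag_d_form j b f :
  d j (ag_form b f) = \sum_k (ag_grad f k * ag_hess b j k +
                              ag_grad b k * ag_hess f j k).
Proof.
rewrite /ag_form ag_d_sum.
under [in LHS]eq_bigr => k _ do rewrite (md_M md).
rewrite big_split big_split /=.
have -> : \sum_k d j (ag_grad b k) * d k f =
  \sum_k ag_cov (ag_grad b) k j * d k f -
  \sum_k ag_grad b k * \sum_p Gam p j k * d p f.
  under [X in X - _]eq_bigr => k _ do rewrite mulrDl.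
  rewrite big_split /= -addrA -[LHS]addr0; congr (_ + _).
  apply/esym/eqP; rewrite subr_eq0; apply/eqP.
  under [in LHS]eq_bigr => k _ do rewrite mulr_suml.
  under [RHS]eq_bigr => k _ do rewrite mulr_sumr.
  by rewrite exchange_big; apply: eq_bigr => k _; apply: eq_bigr => i _ /=; ring.
rewrite addrAC -addrA -sumrB; congr (_ + _); last first.
  by apply: eq_bigr => k _; rewrite -mulrBr.
under [LHS]eq_bigr => k _ do rewrite ag_cov_grad mulr_suml.
rewrite exchange_big /=; apply: eq_bigr => k _.
rewrite [in RHS]/ag_grad mulr_suml; apply: eq_bigr => p _.
by rewrite (ag_hC k p); ring.
Qed.

(* Through the next identity the Hessian, and hence the Laplacian, is determined by
   the form <grad a, grad b> alone; this makes it independent of the coordinates. *)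
Definition ag_koszul (f a b : A) : A :=
  ag_form a (ag_form b f) + ag_form b (ag_form a f) - ag_form f (ag_form a b).

Lemma ag_koszulE f a b :
  ag_koszul f a b =
  2 * \sum_j \sum_k ag_grad a j * ag_grad b k * ag_hess f j k.
Proof.
(* Each iterated form is a sum of two Hessians evaluated on gradients. By symmetry, four of the six
   resulting terms cancel in pairs, and Hess f (grad a, grad b) remains twice. *)
have E (x y z : A) : ag_form x (ag_form y z) =
  \sum_j \sum_k ag_grad x j * ag_grad z k * ag_hess y j k +
  \sum_j \sum_k ag_grad x j * ag_grad y k * ag_hess z j k.
  rewrite /ag_form -big_split /=; apply: eq_bigr => j _.
  rewrite -/(ag_form y z) ag_d_form mulr_sumr -big_split /=; apply: eq_bigr => k _.
  by ring.
have C (x y z : A) : \sum_j \sum_k ag_grad x j * ag_grad z k * ag_hess y j k =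
  \sum_j \sum_k ag_grad z j * ag_grad x k * ag_hess y j k.
  rewrite exchange_big; apply: eq_bigr => j _; apply: eq_bigr => k _ /=.
  by rewrite ag_hessC; ring.
by rewrite /ag_koszul !E (C b f a) (C f b a) (C f a b); ring.
Qed.

Lemma ag_grad_form u k :
  ag_grad (ag_form u u) k = 2 * \sum_i ag_cov (ag_grad u) k i * ag_grad u i.
Proof.
rewrite {1}/ag_grad.
under [in LHS]eq_bigr => j _ do rewrite ag_d_form mulr_sumr.
rewrite exchange_big /= mulr_sumr; apply: eq_bigr => i _.
rewrite ag_cov_grad mulr_suml mulr_sumr; apply: eq_bigr => j _.
by rewrite (ag_hessC u i j); ring.
Qed.

(** Bochner's identity for a vector field that need not be a gradient: div (nabla_X X) = tr ((nabla
    X)^2) + X (div X) + Ric (X, X). Curvature appears when nabla_k nabla_i X^k is exchanged for the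
    derivative of the divergence. *)
Lemma ag_div_cov (X : 'I_n -> A) :
  \sum_k ag_cov (fun k => \sum_i ag_cov X k i * X i) k k =
  \sum_k \sum_i ag_cov X k i * ag_cov X i k
  + \sum_i X i * d i (\sum_k ag_cov X k k)
  + \sum_i \sum_k X i * X k * ag_ricci i k.
Proof.
have step1 : \sum_k ag_cov (fun k => \sum_i ag_cov X k i * X i) k k =
  \sum_i \sum_k (X i * d k (ag_cov X k i) + ag_cov X k i * d k (X i)
    + \sum_j Gam k k j * ag_cov X j i * X i).
  rewrite exchange_big; apply: eq_bigr => k _; rewrite {1}/ag_cov ag_d_sum.
  rewrite [in RHS]big_split /=; congr (_ + _).
    by apply: eq_bigr => i _; rewrite (md_M md) mulrC.
  rewrite exchange_big; apply: eq_bigr => j _; rewrite mulr_sumr.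
  by apply: eq_bigr => i _; rewrite mulrA.
have step2 : \sum_i \sum_k ag_cov X k i * d k (X i) =
   \sum_k \sum_i ag_cov X k i * ag_cov X i k -
   \sum_i \sum_k X i * \sum_l Gam l k i * ag_cov X k l.
  rewrite exchange_big /=.
  transitivity (\sum_k \sum_i (ag_cov X k i * ag_cov X i k -
     \sum_l Gam i k l * X l * ag_cov X k i)).
    apply: eq_bigr => k _; apply: eq_bigr => i _.
    by rewrite -mulr_suml [ag_cov X i k]/ag_cov; ring.
  under [LHS]eq_bigr => k _ do rewrite sumrB.
  rewrite sumrB; congr (_ - _).
  rewrite [RHS]exchange_big; apply: eq_bigr => k _ /=.
  under [RHS]eq_bigr => i _ do rewrite mulr_sumr.
  rewrite [RHS]exchange_big; apply: eq_bigr => i _; apply: eq_bigr => l _ /=.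
  by ring.
(* The contracted Ricci identity: the left side is nabla_k nabla_i X^k - d_i (div X), summed over
   k. *)
have step3 (i : 'I_n) : \sum_k (d k (ag_cov X k i) - d i (ag_cov X k k)
    + \sum_j Gam k k j * ag_cov X j i - \sum_l Gam l k i * ag_cov X k l) =
  \sum_k X k * ag_ricci i k.
  have e1 k : d k (ag_cov X k i) - d i (ag_cov X k k) =
     \sum_l (d k (Gam k i l) * X l + Gam k i l * d k (X l))
     - \sum_l (d i (Gam k k l) * X l + Gam k k l * d i (X l)).
    rewrite /ag_cov !(md_D md) (md_C md k i) !ag_d_sum.
    under [in LHS]eq_bigr => l _ do rewrite (md_M md).
    under [X in _ - (_ + X)]eq_bigr => l _ do rewrite (md_M md).
    by ring.
  have e2 k : \sum_j Gam k k j * ag_cov X j i =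
     \sum_j Gam k k j * d i (X j) + \sum_j \sum_l Gam k k j * Gam j i l * X l.
    rewrite -big_split; apply: eq_bigr => j _ /=; rewrite mulrDr mulr_sumr.
    by under [in LHS]eq_bigr => l _ do rewrite mulrA.
  have e3 k : \sum_j Gam j k i * ag_cov X k j =
     \sum_j Gam j k i * d j (X k) + \sum_j \sum_l Gam j k i * Gam k j l * X l.
    rewrite -big_split; apply: eq_bigr => j _ /=; rewrite mulrDr mulr_sumr.
    by under [in LHS]eq_bigr => l _ do rewrite mulrA.
  under [LHS]eq_bigr => k _ do rewrite e1 e2 e3 !big_split /=.
  (* The curvature terms are separated from two differences that vanish: the first derivatives of X,
     by symmetry of the lower indices, and products of Christoffel symbols that differ by an
     exchange of summation indices. *)
  transitivity (\sum_k (\sum_l d k (Gam k i l) * X l - \sum_l d i (Gam k k l) * X l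
     + \sum_j \sum_l Gam k k j * Gam j i l * X l
     - \sum_j \sum_l Gam k j i * Gam j k l * X l)
     + (\sum_k \sum_l Gam k i l * d k (X l) - \sum_k \sum_j Gam j k i * d j (X k))
     + (\sum_k \sum_j \sum_l Gam k j i * Gam j k l * X l
        - \sum_k \sum_j \sum_l Gam j k i * Gam k j l * X l)).
    rewrite -!sumrB -!big_split /=; apply: eq_bigr => k _; ring.
  rewrite [X in _ + (X - _)]exchange_big subrr addr0.
  have -> : \sum_k \sum_l Gam k i l * d k (X l) = \sum_k \sum_j Gam j k i * d j (X k).
    rewrite exchange_big; apply: eq_bigr => k _; apply: eq_bigr => j _ /=.
    by rewrite ag_christoffelC.
  rewrite subrr addr0.
  under [RHS]eq_bigr => k _ do rewrite mulr_sumr.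
  rewrite [RHS]exchange_big; apply: eq_bigr => k _ /=.
  rewrite exchange_big /= [in X in _ - X]exchange_big /= -!sumrB -big_split -sumrB /=.
  apply: eq_bigr => l _.
  rewrite mulrDr mulr_sumr -addrA -sumrB; congr (_ + _); first by ring.
  by apply: eq_bigr => j _; rewrite (ag_christoffelC k i j); ring.
rewrite step1.
transitivity (\sum_i \sum_k ag_cov X k i * d k (X i) +
   \sum_i \sum_k (X i * d k (ag_cov X k i) + \sum_j Gam k k j * ag_cov X j i * X i)).
  rewrite -big_split; apply: eq_bigr => i _; rewrite -big_split; apply: eq_bigr => k _ /=.
  by ring.
rewrite step2 -!addrA; congr (_ + _); rewrite addrC -sumrB -big_split.
apply: eq_bigr => i _ /=.
have -> : \sum_k X i * X k * ag_ricci i k = X i * \sum_k X k * ag_ricci i k.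
  by rewrite mulr_sumr; apply: eq_bigr => k _; rewrite mulrA.
rewrite -step3 -mulrDr ag_d_sum -big_split /= -sumrB mulr_sumr.
by apply: eq_bigr => k _; rewrite -mulr_suml; ring.
Qed.

Lemma eq_ag_cov (X Y : 'I_n -> A) : X =1 Y -> ag_cov X =2 ag_cov Y.
Proof. by move=> XY k j; rewrite /ag_cov XY; under [in LHS]eq_bigr do rewrite XY. Qed.

(** By [ag_grad_form] the gradient of |grad u|^2 is 2 nabla_{grad u} grad u, so [ag_div_cov] applies
    with X = grad u. The first double sum, the trace of the square of nabla grad u, is |Hess
    u|^2. *)
Lemma ag_bochner u :
  ag_lap (ag_form u u) =
  2 * (\sum_k \sum_i ag_cov (ag_grad u) k i * ag_cov (ag_grad u) i k
  + ag_form u (ag_lap u)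
  + \sum_i \sum_k ag_grad u i * ag_grad u k * ag_ricci i k).
Proof.
rewrite /ag_form -ag_div_cov /ag_lap mulr_sumr; apply: eq_bigr => k _.
rewrite -/(ag_form u u) (eq_ag_cov (ag_grad_form u)) /ag_cov.
under [X in _ + X]eq_bigr => l _ do rewrite mulrCA.
by rewrite -mulr_sumr mulrDr !mulrDl !mul1r (md_D md).
Qed.

Lemma ag_gradM a b k : ag_grad (a * b) k = a * ag_grad b k + b * ag_grad a k.
Proof.
rewrite /ag_grad !mulr_sumr -big_split; apply: eq_bigr => j _ /=.
by rewrite (md_M md); ring.
Qed.

Lemma ag_divM a (X : 'I_n -> A) :
  \sum_k ag_cov (fun k => a * X k) k k = a * (\sum_k ag_cov X k k) + \sum_k X k * d k a.
Proof.
rewrite mulr_sumr -big_split; apply: eq_bigr => k _ /=.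
rewrite /ag_cov (md_M md) mulrDr mulr_sumr.
by under [in LHS]eq_bigr => l _ do rewrite mulrCA; ring.
Qed.

Lemma ag_lapM a b :
  ag_lap (a * b) = a * ag_lap b + b * ag_lap a + 2 * ag_form a b.
Proof.
have -> : ag_lap (a * b) = \sum_k ag_cov (fun k => a * ag_grad b k) k k +
    \sum_k ag_cov (fun k => b * ag_grad a k) k k.
  rewrite -big_split; apply: eq_bigr => k _ /=.
  rewrite (eq_ag_cov (ag_gradM a b)) /ag_cov (md_D md).
  under [in LHS]eq_bigr => l _ do rewrite mulrDr.
  by rewrite big_split /=; ring.
rewrite !ag_divM -/(ag_form b a) -/(ag_form a b) (ag_formC b a) -/(ag_lap a) -/(ag_lap b).
by ring.
Qed.

End MetricAlgebra.

(** * Invariance of the Laplacian under a change of coordinates *)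

Section MetricChange.
Variables (A A' : comNzRingType) (n : nat).
Variables (d : 'I_n -> A -> A) (g h : 'M[A]_n) (half : A).
Variables (d' : 'I_n -> A' -> A') (g' h' : 'M[A']_n) (half' : A').
Hypothesis md : metricData d g h half.
Hypothesis md' : metricData d' g' h' half'.
(** [P] stands for the pull-back along the coordinate change, [J] for its Jacobian matrix and [z]
    for the target coordinate functions; [dP] is the chain rule. *)
Variables (P : {rmorphism A' -> A}) (J : 'M[A]_n) (z : 'I_n -> A').
Hypothesis dP : forall i f, d i (P f) = \sum_a J i a * P (d' a f).
Hypothesis gP : g = J *m map_mx P g' *m J^T.
Hypothesis dz : forall a p, d' a (z p) = (a == p)%:R.

(** The matrix [h *m J *m map_mx P g'] is a left inverse of [J^T], hence also a right inverse:
    nondegeneracy of the metric supplies the invertibility of the Jacobian. *)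
Let inv_change : J^T *m h *m J = map_mx P h'.
Proof.
have g'K : map_mx P g' *m map_mx P h' = 1%:M.
  by rewrite -map_mxM (ag_gh md') map_mx1.
have : h *m J *m map_mx P g' *m J^T = 1%:M.
  by rewrite -(md_hg md) gP !mulmxA.
move=> /mulmx1C; rewrite !mulmxA => /(congr1 (mulmx^~ (map_mx P h'))).
by rewrite mul1mx -[LHS]mulmxA g'K mulmx1.
Qed.

Let form_mx (B : comNzRingType) (e : 'I_n -> B -> B) (k : 'M[B]_n) a b :
  ag_form e k a b = ((\col_i e i b)^T *m k *m (\col_i e i a)) 0 0.
Proof.
rewrite -mulmxA mxE; apply: eq_bigr => i _; rewrite !mxE mulrC; congr (_ * _).
by apply: eq_bigr => j _; rewrite !mxE.
Qed.

Let col_change f : \col_i d i (P f) = J *m map_mx P (\col_i d' i f).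
Proof. by apply/colP => i; rewrite !mxE dP; apply: eq_bigr => a _; rewrite !mxE. Qed.

Lemma ag_form_change a b : P (ag_form d' h' a b) = ag_form d h (P a) (P b).
Proof.
rewrite !form_mx !col_change trmx_mul !mulmxA.
rewrite -(mulmxA _ J^T) -(mulmxA _ (J^T *m h)) inv_change map_trmx -!map_mxM.
by rewrite [RHS]mxE.
Qed.

Lemma ag_koszul_change f a b :
  P (ag_koszul d' h' f a b) = ag_koszul d h (P f) (P a) (P b).
Proof. by rewrite /ag_koszul rmorphB rmorphD !ag_form_change. Qed.

(** The gradients of the coordinate functions are the columns of [h'], so contraction with [g']
    rebuilds the trace of the Hessian. The Laplacian is thereby written through [ag_form] alone, up
    to the coefficients [g']. *)
Let lap_koszul f :
  ag_lap d' g' h' half' f =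
  half' * \sum_p \sum_q g' p q * ag_koszul d' h' f (z p) (z q).
Proof.
have gz p j : ag_grad d' h' (z p) j = h' j p.
  by rewrite /ag_grad (bigD1 p)//= dz eqxx mulr1 big1 ?addr0 // => i /negPf ip; rewrite dz ip mulr0.
rewrite (ag_lapE md') mulr_sumr.
transitivity (\sum_p \sum_q \sum_j \sum_k g' p q * h' j p * h' k q * ag_hess d' g' h' half' f j k).
  under [RHS]eq_bigr => p _ do rewrite exchange_big.
  rewrite [RHS]exchange_big; apply: eq_bigr => j _ /=.
  under [RHS]eq_bigr => p _ do rewrite exchange_big.
  rewrite [RHS]exchange_big; apply: eq_bigr => k _ /=.
  rewrite exchange_big /=.
  transitivity (\sum_q (j == q)%:R * (h' k q * ag_hess d' g' h' half' f j k)).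
    by rewrite ag_sum_delta (ag_hC md').
  apply: eq_bigr => q _; rewrite -(ag_raise_g md') mulr_suml.
  by apply: eq_bigr => p _; ring.
apply: eq_bigr => p _; rewrite mulr_sumr; apply: eq_bigr => q _.
rewrite (ag_koszulE md').
set S := (\sum_j \sum_k _ in RHS).
have -> : half' * (g' p q * (2 * S)) = (half' + half') * (g' p q * S) by ring.
rewrite (md_half md') mul1r mulr_sumr; apply: eq_bigr => j _.
by rewrite mulr_sumr; apply: eq_bigr => k _; rewrite !gz; ring.
Qed.

Lemma ag_lap_change f : P (ag_lap d' g' h' half' f) = ag_lap d g h half (P f).
Proof.
have Phalf : P half' = half.
  have := congr1 P (md_half md'); rewrite rmorphD rmorph1 => E.
  by rewrite -[LHS]mulr1 -(md_half md) mulrDr -mulrDl E mul1r.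
rewrite lap_koszul rmorphM Phalf rmorph_sum (ag_lapE md).
under eq_bigr => p _ do rewrite rmorph_sum.
have gz p j : ag_grad d h (P (z p)) j = (h *m J) j p.
  rewrite /ag_grad mxE; apply: eq_bigr => i _; rewrite dP (bigD1 p)//= dz eqxx.
  by rewrite rmorph1 mulr1 big1 ?addr0 // => a /negPf ap; rewrite dz ap rmorph0 mulr0.
transitivity (\sum_p \sum_q \sum_j \sum_k P (g' p q) * (h *m J) j p * (h *m J) k q
    * ag_hess d g h half (P f) j k).
  rewrite mulr_sumr; apply: eq_bigr => p _; rewrite mulr_sumr; apply: eq_bigr => q _.
  rewrite rmorphM ag_koszul_change (ag_koszulE md).
  set S := (\sum_j \sum_k _ in LHS).
  have -> : half * (P (g' p q) * (2 * S)) = (half + half) * (P (g' p q) * S) by ring.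
  rewrite (md_half md) mul1r mulr_sumr; apply: eq_bigr => j _.
  by rewrite mulr_sumr; apply: eq_bigr => k _; rewrite !gz; ring.
under eq_bigr => p _ do rewrite exchange_big.
rewrite exchange_big; apply: eq_bigr => j _ /=.
under eq_bigr => p _ do rewrite exchange_big.
rewrite exchange_big; apply: eq_bigr => k _ /=.
have -> : h j k = (h *m J *m map_mx P g' *m (h *m J)^T) j k.
  rewrite trmx_mul -[h^T]/(h^T).
  have -> : h^T = h by apply/matrixP => a b; rewrite mxE (ag_hC md).
  by rewrite mulmxA -(mulmxA h) -(mulmxA h) -gP (md_hg md) mul1mx.
rewrite [in RHS]mxE mulr_suml exchange_big; apply: eq_bigr => q _ /=.
rewrite [in RHS]mxE mulr_suml mulr_suml; apply: eq_bigr => p _.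
by rewrite !mxE; ring.
Qed.

End MetricChange.

(** * The evolution of the pressure and of its Laplacian *)

Section PressureEquation.
Variables (A : comNzRingType) (n : nat) (d : 'I_n -> A -> A).
Variables (g h : 'M[A]_n) (half : A).
Hypothesis md : metricData d g h half.
Notation grad := (ag_grad d h).
Notation lap := (ag_lap d g h half).
Notation form := (ag_form d h).

Lemma ag_lapD a b : lap (a + b) = lap a + lap b.
Proof.
rewrite !(ag_lapE md) -big_split; apply: eq_bigr => k _.
rewrite -big_split; apply: eq_bigr => l _ /=; rewrite -mulrDr; congr (_ * _).
rewrite /ag_hess !(md_D md); under eq_bigr => p _ do rewrite (md_D md) mulrDr.
by rewrite big_split /=; ring.
Qed.

Lemma ag_lap_const c : (forall i, d i c = 0) -> lap c = 0.
Proof.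
move=> dc; rewrite (ag_lapE md) big1 // => k _; rewrite big1 // => l _.
rewrite /ag_hess dc (ag_d0 md) big1 ?subr0 ?mulr0 // => p _.
by rewrite dc mulr0.
Qed.

Lemma ag_form_const c a : (forall i, d i c = 0) -> form c a = 0.
Proof.
by move=> dc; rewrite (ag_formC md) /ag_form big1 // => k _; rewrite dc mulr0.
Qed.

Lemma ag_lapZ c a : (forall i, d i c = 0) -> lap (c * a) = c * lap a.
Proof.
by move=> dc; rewrite (ag_lapM md) (ag_lap_const dc) (ag_form_const _ dc) !mulr0 !addr0.
Qed.

(** In the application [r] is the solution rho at a fixed time, [ri] its inverse, [rt] its time
    derivative, p = rho^(m-1) and q = rho^(1-m); so [p * r] is rho^m and [r * q] is rho^(2-m). Real
    powers enter only through these relations. *)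
Variables (m r ri rt p q U v vt : A).
Hypothesis dm : forall i, d i m = 0.
Hypothesis rK : r * ri = 1.
Hypothesis pK : p * q = 1.
Hypothesis dp : forall i, d i p = (m - 1) * p * ri * d i r.
Hypothesis dv : forall i, d i v = m * p * ri * d i r.
Hypothesis vE : (m - 1) * v = m * p.
Hypothesis vtE : vt = m * p * ri * rt.
Hypothesis rtE : rt = lap (p * r) + U * (r * q).

(** Since grad (rho^m) = rho grad v, the Laplacian of rho^m is rho Lap v + <grad v, grad rho>;
    multiplication by m p / rho turns the second term into |grad v|^2. The coefficient (m-1) v is
    kept as [m * p], whose positivity is visible for both signs of m - 1. *)
Lemma ag_pressure : vt = m * p * lap v + form v v + m * U.
Proof.
have dpr i : d i (p * r) = r * d i v.
  rewrite (md_M md) dp dv.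
  transitivity ((m - 1) * p * d i r * (r * ri) + p * d i r); first by ring.
  by rewrite rK; transitivity (m * p * d i r * (r * ri)); [rewrite rK; ring | ring].
have gpr k : grad (p * r) k = r * grad v k.
  by rewrite /ag_grad mulr_sumr; apply: eq_bigr => j _; rewrite dpr; ring.
have lpr : lap (p * r) = r * lap v + \sum_k grad v k * d k r.
  rewrite -(ag_divM md) /ag_lap; apply: eq_bigr => k _.
  exact: eq_ag_cov.
have fE : form v v = m * p * ri * \sum_k grad v k * d k r.
  by rewrite mulr_sumr; apply: eq_bigr => k _; rewrite dv; ring.
rewrite vtE rtE lpr fE.
transitivity (m * p * (r * ri) * lap v + m * p * ri * (\sum_k grad v k * d k r)
   + m * U * (r * ri) * (p * q)); first by ring.
by rewrite rK pK; ring.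
Qed.

(** The term quadratic in [lap v] arises from lap (m p) = (m - 1) lap v. Both forms paired with
    [lap v] vanish at a critical point of [lap v]. *)
Lemma ag_pressure_lap :
  lap vt = m * p * lap (lap v) + (m - 1) * lap v * lap v + 2 * form (m * p) (lap v)
  + 2 * (\sum_k \sum_i ag_cov d g h half (grad v) k i * ag_cov d g h half (grad v) i k
  + form v (lap v)
  + \sum_i \sum_k grad v i * grad v k * ag_ricci d g h half i k)
  + m * lap U.
Proof.
have dm1 i : d i (m - 1) = 0.
  rewrite (ag_dB md) dm sub0r; have := md_M md i 1 1.
  by rewrite !mulr1 mul1r -[LHS]addr0 => /addrI <-; rewrite oppr0.
rewrite ag_pressure !ag_lapD (ag_lapM md (m * p)) (ag_bochner md) (ag_lapZ U dm).
by rewrite -{2}vE (ag_lapZ v dm1); ring.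
Qed.

End PressureEquation.

(** * Traces of positive definite matrices *)

Section PositiveDefinite.
Variable R : rcfType.

(** Cholesky factorisation by induction on the size: the Schur complement of the upper left entry is
    again symmetric and positive definite. *)
Lemma posdef_factor n (h : 'M[R]_n) : h^T = h ->
  (forall v : 'rV_n, v != 0 -> 0 < (v *m h *m v^T) 0 0) ->
  exists P : 'M[R]_n, h = P^T *m P.
Proof.
elim: n h => [|n IH] h hT hpos; first by exists 0; apply/matrixP => -[].
rewrite -add1n in h hT hpos *.
set a := ulsubmx h; set w := ursubmx h; set D := drsubmx h.
have hE : h = block_mx a w w^T D.
  by rewrite -[LHS]submxK /w trmx_ursub hT.
have DT : D^T = D by rewrite /D trmx_drsub hT.
have a0 : 0 < a 0 0.
  have /hpos : row_mx 1%:M 0 != 0 :> 'rV[R]_(1 + n).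
    apply/eqP => /(congr1 lsubmx); rewrite row_mxKl linear0 => /matrixP/(_ 0 0).
    by rewrite !mxE => /eqP; rewrite oner_eq0.
  by rewrite hE mul_row_block tr_row_mx mul_row_col !mul0mx !mul1mx trmx0 mulmx0
     !addr0 trmx1 mulmx1.
have aE : a = (a 0 0)%:M by apply: mx11_scalar.
set s := a 0 0 in a0 aE.
have s0 : s != 0 by rewrite gt_eqF.
have [|x x0|P' P'E] := IH (D - s^-1 *: (w^T *m w)).
- by rewrite linearB linearZ /= trmx_mul trmxK DT.
(* For given [x] this first entry minimises the quadratic form, whose value there is that of the
   Schur complement at [x]. *)
- have /hpos : row_mx (- s^-1 *: (x *m w^T)) x != 0.
    apply: contra x0 => /eqP/(congr1 rsubmx).
    by rewrite row_mxKr linear0 => ->.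
  rewrite hE mul_row_block tr_row_mx mul_row_col aE.
  rewrite mul_mx_scalar scalerA mulrN mulfV // scaleN1r addNr mul0mx add0r.
  by rewrite -scalemxAl scaleNr addrC mulmxBr mulmxBl -scalemxAr -scalemxAl !mulmxA mulmxBl -scalemxAl.
exists (block_mx (Num.sqrt s)%:M ((Num.sqrt s)^-1 *: w) 0 P').
have sq : Num.sqrt s * Num.sqrt s = s by rewrite -expr2 sqr_sqrtr // ltW.
have sq0 : Num.sqrt s != 0 by rewrite sqrtr_eq0 -ltNge.
rewrite tr_block_mx mulmx_block tr_scalar_mx trmx0 !mul0mx !mulmx0 !addr0.
rewrite -scalar_mxM sq hE aE mul_scalar_mx scalerA mulfV // scale1r linearZ /=.
rewrite -scalemxAl mul_mx_scalar scalerA mulVf // scale1r -P'E.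
by rewrite -scalemxAl -scalemxAr scalerA -invfM sq addrC subrK.
Qed.

Lemma sum_sq_le n (x : 'I_n -> R) :
  (\sum_i x i) ^+ 2 <= n%:R * \sum_i x i ^+ 2.
Proof.
have : 0 <= \sum_i \sum_j (x i - x j) ^+ 2.
  by apply: sumr_ge0 => i _; apply: sumr_ge0 => j _; apply: sqr_ge0.
have -> : \sum_i \sum_j (x i - x j) ^+ 2 =
  2 * (n%:R * \sum_i x i ^+ 2 - (\sum_i x i) ^+ 2).
  have e i : \sum_j (x i - x j) ^+ 2 =
     n%:R * x i ^+ 2 - 2 * x i * (\sum_j x j) + \sum_j x j ^+ 2.
    have -> : n%:R * x i ^+ 2 = \sum_(j < n) x i ^+ 2.
      by rewrite sumr_const card_ord mulr_natl.
    rewrite mulr_sumr -sumrB -big_split; apply: eq_bigr => j _ /=; ring.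
  under eq_bigr => i _ do rewrite e.
  rewrite big_split sumrB /= sumr_const card_ord -mulr_sumr -mulr_suml -mulr_sumr.
  by rewrite -mulr_natl; ring.
by rewrite pmulr_rge0 // subr_ge0.
Qed.

(** For the inverse metric [h] and the Hessian [B] this is (Lap u)^2 <= n |Hess u|^2. The product
    [h *m B] need not be symmetric; with h = P^T P it is replaced by P B P^T, which is symmetric and
    has the same traces, so that its off-diagonal entries contribute squares. *)
Lemma sqr_mxtrace_le n (h B : 'M[R]_n) : h^T = h ->
  (forall v : 'rV_n, v != 0 -> 0 < (v *m h *m v^T) 0 0) -> B^T = B ->
  (\tr (h *m B)) ^+ 2 <= n%:R * \tr ((h *m B) *m (h *m B)).
Proof.
move=> hT /(posdef_factor hT)[P ->] BT.
pose N := P *m B *m P^T.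
have NT : N^T = N by rewrite /N !trmx_mul trmxK BT mulmxA.
have -> : \tr (P^T *m P *m B) = \tr N by rewrite -mulmxA mxtrace_mulC.
have -> : \tr (P^T *m P *m B *m (P^T *m P *m B)) = \tr (N *m N).
  by rewrite /N -!mulmxA mxtrace_mulC !mulmxA.
clearbody N.
apply: le_trans (sum_sq_le _) _; rewrite ler_wpM2l // /mxtrace.
apply: ler_sum => i _; rewrite [leRHS]mxE (bigD1 i) //= -expr2 lerDl.
by apply: sumr_ge0 => j _; rewrite -{2}NT mxE -expr2 sqr_ge0.
Qed.

(** With h = P^T P the trace is the sum of the values of the quadratic form [B] on the rows of P. *)
Lemma mxtrace_mul_le0 n (h B : 'M[R]_n) : h^T = h ->
  (forall v : 'rV_n, v != 0 -> 0 < (v *m h *m v^T) 0 0) ->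
  (forall v : 'rV_n, (v *m B *m v^T) 0 0 <= 0) -> \tr (h *m B) <= 0.
Proof.
move=> hT /(posdef_factor hT)[P ->] Bneg.
rewrite -mulmxA mxtrace_mulC; apply: sumr_le0 => i _.
apply: le_trans (Bneg (row i P)); rewrite le_eqVlt; apply/orP; left; apply/eqP.
by rewrite tr_row -row_mul [RHS]mxE [LHS]mxE; apply: eq_bigr => j _; rewrite !mxE.
Qed.

Lemma posdef_unit n (g : 'M[R]_n) :
  (forall v : 'rV_n, v != 0 -> 0 < (v *m g *m v^T) 0 0) -> g \in unitmx.
Proof.
move=> gpos; rewrite -row_free_unit -kermx_eq0; apply/rowV0P => v /sub_kermxP vg.
by apply/eqP/negPn/negP => /gpos; rewrite vg mul0mx mxE ltxx.
Qed.

Lemma posdef_inv n (g h : 'M[R]_n) : h *m g = 1%:M -> g^T = g ->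
  (forall v : 'rV_n, v != 0 -> 0 < (v *m g *m v^T) 0 0) ->
  forall v : 'rV_n, v != 0 -> 0 < (v *m h *m v^T) 0 0.
Proof.
move=> hg gT gpos v v0.
have hT : h^T = h.
  have : g *m h^T = 1%:M by rewrite -{1}gT -trmx_mul hg trmx1.
  by move=> /(congr1 (mulmx h)); rewrite mulmxA hg mul1mx mulmx1.
have : v *m h != 0.
  apply: contra v0 => /eqP/(congr1 (mulmx^~ g)).
  by rewrite -mulmxA hg mulmx1 mul0mx => ->.
by move=> /gpos; rewrite trmx_mul hT -(mulmxA v) hg mulmx1 mulmxA.
Qed.

End PositiveDefinite.

(** * Functions smooth on an open set *)

Section DirectionalCalculus.
Variables (R : realType) (V : normedModType R).

Lemma is_derive_line (f : V -> R) (z v : V) (s : R) :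
  derivable f (s *: v + z) v ->
  is_derive s 1 (fun s => f (s *: v + z)) ('D_v f (s *: v + z)).
Proof.
have E : (fun h : R => h^-1 *: (f ((h *: (1 : R) + s) *: v + z) - f (s *: v + z)))
   = (fun h => h^-1 *: (f (h *: v + (s *: v + z)) - f (s *: v + z))).
  by apply/funext => h; rewrite [h *: 1]mulr1 scalerDl addrA.
move=> df; apply: DeriveDef; first by rewrite /derivable /= E.
by rewrite /derive /= E.
Qed.

Lemma MVT_line (f : V -> R) (z v : V) (t : R) :
  (forall s, `|s| <= `|t| -> derivable f (s *: v + z) v) ->
  exists2 s, `|s| <= `|t| & f (t *: v + z) - f z = t * 'D_v f (s *: v + z).
Proof.
move=> df; pose p s := f (s *: v + z).
have dp (s : R) : `|s| <= `|t| -> is_derive s 1 p ('D_v f (s *: v + z)).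
  by move=> /df; exact: is_derive_line.
have cp (s : R) : `|s| <= `|t| -> {for s, continuous p}.
  move=> /dp ps; have /derivable1_diffP : derivable p s 1 by apply: ex_derive.
  exact: differentiable_continuous.
have p0 : p 0 = f z by rewrite /p scale0r add0r.
have [t0|t0] := leP 0 t.
  have b s : s \in `[0, t]%R -> `|s| <= `|t|.
    by rewrite in_itv /= => /andP[s0 st]; rewrite !ger0_norm.
  have [s|s|s sI E] := @MVT_segment _ p (fun s => 'D_v f (s *: v + z)) 0 t t0.
  - by move=> sI; apply/dp/b; exact: subset_itv_oo_cc sI.
  - by apply: continuous_in_subspaceT => {}s /set_mem sI; exact/cp/b.
  exists s; first exact: b.
  by rewrite -p0 -/(p t) E subr0 mulrC.
have b s : s \in `[t, 0]%R -> `|s| <= `|t|.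
  rewrite in_itv /= => /andP[s0 st].
  by rewrite !ler0_norm ?lerN2 // ltW.
have [s|s|s sI E] := @MVT_segment _ p (fun s => 'D_v f (s *: v + z)) t 0 (ltW t0).
- by move=> sI; apply/dp/b; exact: subset_itv_oo_cc sI.
- by apply: continuous_in_subspaceT => {}s /set_mem sI; exact/cp/b.
exists s; first exact: b.
by rewrite -p0 -/(p t) -[LHS]opprB E sub0r mulrN opprK mulrC.
Qed.

Lemma derive_shift_point (f : V -> R) (a z v : V) :
  'D_v (fun y => f (y + a)) z = 'D_v f (z + a).
Proof. by rewrite /derive /=; under eq_fun do rewrite -addrA. Qed.

Lemma derivable_shift_point (f : V -> R) (a z v : V) :
  derivable f (z + a) v -> derivable (fun y => f (y + a)) z v.
Proof.
by rewrite /derivable /= => df; under eq_fun do rewrite -addrA.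
Qed.

(** The mean value theorem is used twice: along [v] for the increment of [f] in direction [w], then
    along [w] for the derivative so obtained. *)
Lemma second_difference (f : V -> R) (x v w : V) (s t : R) :
  (forall a b, `|a| <= `|s| -> `|b| <= `|t| ->
     derivable f (a *: v + b *: w + x) v /\
     derivable ('D_v f) (a *: v + b *: w + x) w) ->
  exists a b, [/\ `|a| <= `|s|, `|b| <= `|t| &
    f (s *: v + t *: w + x) - f (s *: v + x) - (f (t *: w + x) - f x) =
    s * t * 'D_w ('D_v f) (a *: v + b *: w + x)].
Proof.
move=> df; pose G z := f (z + t *: w) - f z.
have t1 : `|t| <= `|t| by [].
have dG a : `|a| <= `|s| -> is_derive (a *: v + x) v G
    ('D_v f (a *: v + x + t *: w) - 'D_v f (a *: v + x)).
  move=> a1; rewrite -derive_shift_point.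
  have d1 : derivable (fun z => f (z + t *: w)) (a *: v + x) v.
    by apply: derivable_shift_point; rewrite addrAC; exact: (df _ _ a1 t1).1.
  have d2 : derivable f (a *: v + x) v.
    have := (df a 0 a1 _).1; rewrite scale0r addr0; apply.
    by rewrite normr0.
  exact: (is_deriveB (derivableP d1) (derivableP d2)).
have [|a a1 E] := @MVT_line G x v s.
  by move=> a /dG da; exact: ex_derive.
have [|b b1 E'] := @MVT_line ('D_v f) (a *: v + x) w t.
  by move=> b b1; have := (df a b a1 b1).2; rewrite addrA [b *: w + _]addrC.
exists a, b; split; [exact: a1|exact: b1|].
move: E; have -> := @derive_val _ _ _ _ _ _ _ (dG a a1); rewrite [a *: v + x + _]addrC E' /G.
rewrite mulrA [in RHS]addrA [b *: w + _]addrC => <-; congr (f _ - _ - (f _ - _)).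
  by rewrite addrAC.
by rewrite addrC.
Qed.

(** Schwarz's theorem. The second difference is symmetric in the two directions, so the mixed
    derivatives take a common value at two points arbitrarily near [x]; continuity does the rest. *)
Lemma derive_comm (f : V -> R) (x v w : V) :
  (\near x, derivable f x v /\ derivable f x w) ->
  (\near x, derivable ('D_v f) x w /\ derivable ('D_w f) x v) ->
  {for x, continuous ('D_w ('D_v f))} -> {for x, continuous ('D_v ('D_w f))} ->
  'D_w ('D_v f) x = 'D_v ('D_w f) x.
Proof.
move=> df ddf c1 c2; apply/eqP; rewrite -subr_eq0 -normr_le0.
apply/ler_addgt0Pr => e e0; rewrite add0r.
pose good z := [/\ derivable f z v /\ derivable f z w,
  derivable ('D_v f) z w /\ derivable ('D_w f) z v,
  `|'D_w ('D_v f) x - 'D_w ('D_v f) z| < e / 2 &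
  `|'D_v ('D_w f) x - 'D_v ('D_w f) z| < e / 2].
have e2 : 0 < e / 2 by rewrite divr_gt0.
have n1 : \forall z \near x, `|'D_w ('D_v f) x - 'D_w ('D_v f) z| < e / 2.
  by move/cvgrPdist_lt : c1; apply; exact: e2.
have n2 : \forall z \near x, `|'D_v ('D_w f) x - 'D_v ('D_w f) z| < e / 2.
  by move/cvgrPdist_lt : c2; apply; exact: e2.
have : \near x, good x.
  apply: filterS (filterI (filterI df ddf) (filterI n1 n2)) => z [[h1 h2] [h3 h4]].
  by split; [exact: h1|exact: h2|exact: h3|exact: h4].
move=> /nbhs_ballP[r /= r0 ball_good].
(* The summand 1 keeps [k] positive when both directions vanish; [s] is then chosen so that
   displacements by at most [s] along each direction stay within r / 2. *)
pose k := `|v| + `|w| + 1.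
have k0 : 0 < k by rewrite ltr_wpDl // addr_ge0.
pose s := r / 2 / k.
have s0 : 0 < s by rewrite !divr_gt0.
have near_s a b : `|a| <= `|s| -> `|b| <= `|s| -> good (a *: v + b *: w + x).
  move=> a1 b1; apply: ball_good.
  rewrite -ball_normE /= opprD addrCA subrr addr0 normrN.
  apply: (@le_lt_trans _ _ (s * k)); last first.
    by rewrite /s divfK ?gt_eqF // ltr_pdivrMr // ltr_pMr // ltr1n.
  apply: le_trans (ler_normD _ _) _; rewrite !normrZ /k !mulrDr mulr1 -[leLHS]addr0.
  rewrite (gtr0_norm s0) in a1 b1.
  apply: lerD; last exact: ltW.
  by apply: lerD; apply: ler_wpM2r.
have [a b a1 b1|a [b [a1 b1 E1]]] := @second_difference f x v w s s.
  have [[d1 _] [d2 _] _ _] := near_s a b a1 b1.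
  by split; [exact: d1|exact: d2].
have [a' b' a1' b1'|a' [b' [a1' b1' E2]]] := @second_difference f x w v s s.
  have [[_ d1] [_ d2] _ _] := near_s b' a' b1' a1'; rewrite [a' *: w + _]addrC.
  by split; [exact: d1|exact: d2].
have : 'D_w ('D_v f) (a *: v + b *: w + x) = 'D_v ('D_w f) (b' *: v + a' *: w + x).
  apply: (@mulfI _ (s * s)); first by rewrite mulf_neq0 ?gt_eqF.
  have swap (A B C D : R) : A - B - (C - D) = A - C - (B - D) by ring.
  rewrite [a' *: w + b' *: v]addrC [s *: w + s *: v]addrC in E2.
  by refine (etrans (esym E1) (etrans _ E2)); exact: swap.
have [_ _ h1 _] := near_s a b a1 b1.
have [_ _ _ h2] := near_s b' a' b1' a1'.
move=> E; rewrite E in h1; rewrite distrC in h2.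
rewrite -(subrK ('D_v ('D_w f) (b' *: v + a' *: w + x)) ('D_w ('D_v f) x)) -addrA.
apply: le_trans (ler_normD _ _) _; rewrite (splitr e); exact: lerD (ltW h1) (ltW h2).
Qed.

End DirectionalCalculus.

Section ContinuouslyDifferentiable.
Variables (R : realType) (n : nat).
Notation V := 'rV[R]_n.

(** [smooth_on] speaks of directional derivatives only, whereas the chain rule needs a full
    differential; continuity of the partial derivatives provides it. *)
Lemma differentiable_of_partials (f : V -> R) (y : V) :
  (\near y, forall i, derivable f y (delta_mx 0 i)) ->
  (forall i, {for y, continuous ('D_(delta_mx 0 i) f)}) ->
  differentiable f y /\
  forall v, 'd f y v = \sum_i v 0 i * 'D_(delta_mx 0 i) f y.
Proof.
move=> df cf; pose D (v : V) : R := \sum_i v 0 i * 'D_(delta_mx 0 i) f y.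
have D_lin : linear D.
  move=> a u v; rewrite /D scaler_sumr -big_split; apply: eq_bigr => i _ /=.
  by rewrite !mxE mulrDl -mulrA.
pose DM := GRing.isLinear.Build _ _ _ _ D D_lin.
pose DL : {linear V -> R} := HB.pack D DM.
have D_cont : continuous DL.
  apply: continuous_big => [|i _ v]; first exact: add_continuous.
  apply: (@continuousM R V (fun v : V => v 0 i)); last exact: cst_continuous.
  exact: coord_continuous.
pose fs : V -> R^o := f \o shift y.
pose fd : V -> R^o := cst (f y) + (DL : V -> R^o).
have D_o : fs = fd +o_ (0 : V) (id : V -> V).
  apply/eqaddoP => _/posnumP[e] /=.
  (* Each of the n coordinate steps costs at most e' times the norm of the increment; n + 1 avoids a
     division by zero in dimension 0. *)
  pose e' := e%:num / n.+1%:R.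
  have e'0 : 0 < e' by rewrite divr_gt0.
  have : \forall z \near y, forall i, derivable f z (delta_mx 0 i) /\
      `|'D_(delta_mx 0 i) f y - 'D_(delta_mx 0 i) f z| < e'.
    near=> z => i; split; first by move: i; near: z.
    move: i; near: z; apply: filter_forall => i.
    by move/cvgrPdist_lt : (cf i); apply.
  move=> /nbhs_ballP[r /= r0 ball_good].
  apply/nbhs_ballP; exists r => //= h; rewrite -ball_normE /= sub0r normrN => hr.
  (* The increment truncated to its first k coordinates: [y + H k] runs along the axes from y to y +
     h, and the sup norm keeps the whole path in the ball. *)
  pose H (k : nat) : V := \row_i (if (i < k)%N then h 0 i else 0).
  have h_coord (i : 'I_n) : `|h 0 i| <= `|h|.
    by rewrite [leRHS]/Num.Def.normr/= mx_normrE; apply: (le_bigmax _ _ (0, i)).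
  have H_step (k : 'I_n) : H k.+1 = h 0 k *: delta_mx 0 k + H k.
    apply/rowP => i; rewrite !mxE eqxx /= ltnS leq_eqVlt.
    have [->|ik] := eqVneq i k; first by rewrite ltnn eqxx /= mulr1 addr0.
    have -> : (i == k :> nat) = false by apply/negbTE.
    by rewrite mulr0 add0r.
  have H_near (k : 'I_n) s : `|s| <= `|h 0 k| ->
      ball y r (s *: delta_mx 0 k + (H k + y)).
    move=> sk; rewrite -ball_normE /= addrA opprD addrCA subrr addr0 normrN.
    apply: le_lt_trans hr; rewrite [leLHS]/Num.Def.normr/= mx_normrE.
    apply: bigmax_le => // -[a i] _ /=; rewrite !mxE [a]ord1 eqxx /=.
    have [->|ik] := eqVneq i k; first by rewrite ltnn mulr1 addr0 (le_trans sk).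
    by rewrite mulr0 add0r; case: ifP => // _; rewrite normr0.
  have claim k : (k <= n)%N ->
    `|f (H k + y) - f y - \sum_(i < n | (i < k)%N) h 0 i * 'D_(delta_mx 0 i) f y|
      <= \sum_(i < n | (i < k)%N) `|h 0 i| * e'.
    elim: k => [_|k IH kn].
      have -> : H 0%N = 0 by apply/rowP => i; rewrite !mxE.
      by rewrite add0r subrr !big_pred0 // subrr normr0.
    pose K := Ordinal kn.
    have sum_step (F : 'I_n -> R) :
        \sum_(i < n | (i < k.+1)%N) F i = F K + \sum_(i < n | (i < k)%N) F i.
      rewrite (bigD1 K) //=; congr (_ + _); apply: eq_bigl => i.
      by rewrite ltnS -val_eqE /= andbC ltn_neqAle.
    have [s|s sK] := @MVT_line R V f (H K + y) (delta_mx 0 K) (h 0 K).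
      by move=> sK; have [+ _] := ball_good _ (H_near K _ sK) K.
    have [_ close] := ball_good _ (H_near K _ sK) K.
    move=> E; rewrite (H_step K) -[h 0 K *: _ + _ + y]addrA !sum_step.
    have -> : f (h 0 K *: delta_mx 0 K + (H K + y)) =
       h 0 K * 'D_(delta_mx 0 K) f (s *: delta_mx 0 K + (H K + y)) + f (H k + y).
      by rewrite -E subrK.
    set S := \sum_(i < n | _) _; set a := 'D__ f (s *: _ + _).
    set b := 'D__ f y in close *.
    have -> : h 0 K * a + f (H k + y) - f y - (h 0 K * b + S) =
       h 0 K * (a - b) + (f (H k + y) - f y - S) by ring.
    apply: le_trans (ler_normD _ _) _; apply: lerD (IH (ltnW kn)).
    by rewrite normrM ler_wpM2l // distrC ltW.
  have Hn : H n = h by apply/rowP => i; rewrite !mxE ltn_ord.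
  have := claim n (leqnn n); rewrite Hn.
  under eq_bigl do rewrite ltn_ord; under [in leRHS]eq_bigl do rewrite ltn_ord.
  have -> : f (h + y) - f y - \sum_(i < n) h 0 i * 'D_(delta_mx 0 i) f y =
     (f \o shift y - (cst (f y) + DL)) h.
    by rewrite -[RHS]/(f (h + y) - (f y + D h)) /D; ring.
  move=> /le_trans; apply; rewrite -mulr_suml.
  apply: (@le_trans _ _ ((n%:R * `|h|) * e')).
    apply: ler_wpM2r; first exact: ltW.
    have -> : n%:R * `|h| = \sum_(i < n) `|h| by rewrite sumr_const card_ord mulr_natl.
    exact: ler_sum.
  have n1 : n%:R / n.+1%:R <= 1 :> R by rewrite ler_pdivrMr // mul1r ler_nat.
  have -> : n%:R * `|h| * e' = n%:R / n.+1%:R * (e%:num * `|h|) by rewrite /e'; ring.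
  by rewrite ler_piMl // mulr_ge0.
have Df : forall v, 'd f y v = \sum_i v 0 i * 'D_(delta_mx 0 i) f y.
  by move=> v; rewrite (diff_unique D_cont D_o).
by split => //; apply/diff_locallyP; rewrite (diff_unique D_cont D_o).
Unshelve. all: by end_near. Qed.

(** As [phi] is only known to be derivable in the direction [v], it is restricted to the line
    through [x], where derivability and differentiability coincide. *)
Lemma derive_comp_partials (V' : normedModType R) (f : V -> R) (phi : V' -> V)
    (x v : V') :
  differentiable f (phi x) ->
  (forall w, 'd f (phi x) w = \sum_i w 0 i * 'D_(delta_mx 0 i) f (phi x)) ->
  derivable phi x v ->
  derivable (f \o phi) x v /\
  'D_v (f \o phi) x =
    \sum_i 'D_v (fun z => phi z 0 i) x * 'D_(delta_mx 0 i) f (phi x).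
Proof.
move=> fd fD phid.
pose p (s : R) := phi (s *: v + x).
have p0 : p 0 = phi x by rewrite /p scale0r add0r.
have /derivable1_diffP pd : derivable p 0 1 by exact: (derivable1P phi x v).1.
rewrite -p0 in fd fD.
have cd : differentiable (f \o p) 0 by apply: differentiable_comp.
have pE : 'd p 0 1 = 'D_v phi x.
  rewrite -deriveE // /derive /p /=; congr (lim _).
  rewrite scale0r add0r.
  by under eq_fun do rewrite [_ *: 1]mulr1 addr0.
have cE : 'D_1 (f \o p) 0 = 'D_v (f \o phi) x.
  rewrite /derive /p /=; congr (lim _).
  rewrite scale0r add0r.
  by under eq_fun do rewrite [_ *: 1]mulr1 addr0.
split; first by apply: (derivable1P (f \o phi) x v).2; apply/derivable1_diffP; exact: cd.
rewrite -cE deriveE // diff_comp //= fD pE p0 derive_mx //.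
by apply: eq_bigr => i _; rewrite mxE.
Qed.

End ContinuouslyDifferentiable.

(** * Closure properties of smooth functions *)

Section SmoothOn.
Variables (R : realType).
Implicit Types V W : normedModType R.

Lemma open_near_eq (T : topologicalType) (S : Type) (A : set T) (x : T) (f g : T -> S) :
  open A -> A x -> (forall y, A y -> f y = g y) -> \near x, f x = g x.
Proof. by move=> oA Ax fg; apply: filterS (open_nbhs_nbhs (conj oA Ax)). Qed.

Lemma continuous_near_eq (T S : topologicalType) (x : T) (f g : T -> S) :
  (\near x, f x = g x) -> {for x, continuous f} -> {for x, continuous g}.
Proof.
move=> fg cf; have E : f x = g x := nbhs_singleton fg.
suff : g @ x --> f x by rewrite E.
by apply: cvg_trans cf; apply: near_eq_cvg; apply: filterS fg => y.
Qed.

(** Smoothness as a greatest fixed point: it suffices to find a class of regular functions stable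
    under directional derivatives up to equality on [A]. No formula for iterated derivatives of
    products or composites is then required. *)
Lemma smooth_on_coind V W (A : set V) (P : (V -> W) -> Prop) : open A ->
  (forall f, P f -> forall x, A x ->
     {for x, continuous f} /\ forall v, derivable f x v) ->
  (forall f v, P f -> exists2 g, P g & forall x, A x -> 'D_v f x = g x) ->
  forall f, P f -> smooth_on A f.
Proof.
move=> oA Preg Pder f Pf vs /=.
have [g Pg fg] : exists2 g, P g & forall x, A x ->
    foldr (fun v h => 'D_v h) f vs x = g x.
  elim: vs => [|v vs [g Pg fg]] /=; first by exists f.
  have [g' Pg' gg'] := Pder g v Pg; exists g' => // x Ax.
  rewrite -gg' //; apply: near_eq_derive.
  exact: open_near_eq fg.
move=> x Ax; have [cg dg] := Preg g Pg x Ax.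
have gf : \near x, g x = foldr (fun v h => 'D_v h) f vs x.
  by apply: (open_near_eq oA Ax) => y Ay; rewrite fg.
split; first exact: continuous_near_eq gf cg.
by move=> v; exact (near_eq_derivable gf (dg v)).
Qed.

Lemma smooth_on_continuous V W (A : set V) (f : V -> W) x :
  smooth_on A f -> A x -> {for x, continuous f}.
Proof. by move=> sf Ax; have [] := sf [::] x Ax. Qed.

Lemma smooth_on_derivable V W (A : set V) (f : V -> W) x v :
  smooth_on A f -> A x -> derivable f x v.
Proof. by move=> sf Ax; have [_] := sf [::] x Ax; exact. Qed.
Arguments smooth_on_derivable [V W A f x] v _ _ [t] _.

Lemma smooth_on_derive V W (A : set V) (f : V -> W) v :
  smooth_on A f -> smooth_on A ('D_v f).
Proof.
move=> sf vs /= x Ax; have := sf (rcons vs v) x Ax.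
by rewrite foldr_rcons.
Qed.

Lemma smooth_on_subset V W (A B : set V) (f : V -> W) :
  B `<=` A -> smooth_on A f -> smooth_on B f.
Proof. by move=> BA sf vs /= x /BA; exact: sf. Qed.

Lemma smooth_on_eq V W (A : set V) (f g : V -> W) : open A ->
  (forall x, A x -> f x = g x) -> smooth_on A f -> smooth_on A g.
Proof.
move=> oA fg sf.
apply: (@smooth_on_coind _ _ A
  (fun g => exists2 f, smooth_on A f & forall x, A x -> f x = g x)) => //.
- move=> {f g fg sf} g [f sf fg] x Ax.
  have n := open_near_eq oA Ax fg.
  split; first exact: continuous_near_eq n (smooth_on_continuous sf Ax).
  by move=> v; exact (near_eq_derivable n (smooth_on_derivable v sf Ax)).
- move=> {f g fg sf} g v [f sf fg]; exists ('D_v f); last first.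
    by move=> x Ax; apply: near_eq_derive; apply: (open_near_eq oA Ax) => y Ay; rewrite fg.
  by exists ('D_v f); [exact: smooth_on_derive|].
- by exists f.
Qed.

Lemma smooth_on_cst V W (A : set V) (c : W) : open A -> smooth_on A (fun=> c).
Proof.
move=> oA; apply: (@smooth_on_coind _ _ A (fun f => exists c, f = fun=> c)) => //.
- by move=> _ [{}c ->] x _; split; [exact: cst_continuous|move=> v; exact: derivable_cst].
- move=> _ v [{}c ->]; exists (fun=> 0); first by exists 0.
  by move=> x _; rewrite derive_cst.
- by exists c.
Qed.

Lemma smooth_on_mx V m n (A : set V) (f : V -> 'M[R]_(m, n)) i j : open A ->
  smooth_on A f -> smooth_on A (fun x => f x i j).
Proof.
move=> oA sf; apply: (@smooth_on_coind _ _ A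
  (fun g => exists2 f : V -> 'M[R]_(m, n), smooth_on A f & g = fun x => f x i j)) => //.
- move=> {f sf} _ [f sf ->] x Ax; split.
    have cf := smooth_on_continuous sf Ax.
    exact: (@continuous_comp _ _ _ f (fun M : 'M[R]_(m, n) => M i j) x cf
      (@coord_continuous R m n i j (f x))).
  by move=> v; exact: (derivable_mxP f x v).1 (smooth_on_derivable v sf Ax) i j.
- move=> {f sf} _ v [f sf ->]; exists (fun x => ('D_v f x : 'M[R]_(m, n)) i j).
    exists ('D_v f); [exact: smooth_on_derive|reflexivity].
  by move=> x Ax; rewrite (derive_mx (smooth_on_derivable v sf Ax)) mxE.
- by exists f.
Qed.

Lemma continuous_rV (T : topologicalType) n (phi : T -> 'rV[R]_n) (x : T) :
  (forall i, {for x, continuous (fun y => phi y 0 i)}) -> {for x, continuous phi}.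
Proof.
move=> cphi; apply/cvgrPdist_le => e e0.
have : \forall y \near x, forall i, `|phi x 0 i - phi y 0 i| <= e.
  by apply: filter_forall => i; move/cvgrPdist_le : (cphi i); apply.
apply: filterS => y h.
rewrite [leLHS]/Num.Def.normr/= mx_normrE; apply: bigmax_le; first exact: ltW.
by move=> -[a i] _ /=; rewrite !mxE [a]ord1; exact: h.
Qed.

Lemma derive_comp_real V (g : R -> R) (f : V -> R) (x v : V) :
  derivable f x v -> derivable g (f x) 1 ->
  is_derive x v (g \o f) ('D_v f x * 'D_1 g (f x)).
Proof.
move=> df dg; pose p (s : R) := f (s *: v + x).
have p0 : p 0 = f x by rewrite /p scale0r add0r.
have pd : derivable p 0 1 := (derivable1P f x v).1 df.
rewrite -p0 in dg *.
have /derivable1_diffP pd' := pd; have /derivable1_diffP gd' := dg.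
have cd : differentiable (g \o p) 0 by apply: differentiable_comp.
have gp : derivable (g \o p) 0 1 by apply/derivable1_diffP; exact: cd.
have E (h : V -> R) : 'D_1 (fun s : R => h (s *: v + x)) 0 = 'D_v h x.
  rewrite /derive /=; congr (lim _); rewrite scale0r add0r.
  by under eq_fun do rewrite [_ *: 1]mulr1 addr0.
apply: DeriveDef; first exact: (derivable1P (g \o f) x v).2 gp.
have c := @derive1_comp R p g 0 pd dg; rewrite !derive1E in c.
have Eg : 'D_1 (g \o p) 0 = 'D_v (g \o f) x := E (g \o f).
have Ef : 'D_1 p 0 = 'D_v f x := E f.
by rewrite -Eg c Ef mulrC.
Qed.

Lemma is_derive_powR_comp V (f : V -> R) (a : R) (x v : V) :
  derivable f x v -> 0 < f x ->
  is_derive x v (fun x => f x `^ a) ('D_v f x * (a * f x `^ (a - 1))).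
Proof.
move=> df f0; have pd := is_derive1_powR a f0.
have := derive_comp_real df (@ex_derive _ _ _ _ _ _ _ pd).
by rewrite (@derive_val _ _ _ _ _ _ _ pd).
Qed.

(* On [A], a directional derivative of a generated function is again a generated
   function, so generated functions are smooth by [smooth_on_coind]. *)
Inductive smooth_gen V (A : set V) : (V -> R) -> Prop :=
| sg_smooth f : smooth_on A f -> smooth_gen A f
| sg_add f g : smooth_gen A f -> smooth_gen A g -> smooth_gen A (fun x => f x + g x)
| sg_mul f g : smooth_gen A f -> smooth_gen A g -> smooth_gen A (fun x => f x * g x)
| sg_inv f : smooth_gen A f -> (forall x, A x -> f x != 0) ->
    smooth_gen A (fun x => (f x)^-1)
| sg_powR a f : smooth_gen A f -> (forall x, A x -> 0 < f x) ->
    smooth_gen A (fun x => f x `^ a)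
| sg_comp n (B : set 'rV[R]_n) (h : 'rV[R]_n -> R) (phi : V -> 'rV[R]_n) :
    open B -> smooth_on B h -> (forall x, A x -> B (phi x)) ->
    (forall i, smooth_gen A (fun x => phi x 0 i)) -> smooth_gen A (h \o phi).

Lemma smooth_gen_sum V (A : set V) n (F : 'I_n -> V -> R) : open A ->
  (forall i, smooth_gen A (F i)) -> smooth_gen A (fun x => \sum_i F i x).
Proof.
move=> oA sF; rewrite (_ : (fun x => _) = \sum_i F i); last first.
  by apply/funext => x; rewrite fct_sumE.
apply: big_ind => //; first by apply: sg_smooth; exact: smooth_on_cst.
by move=> f g; exact: sg_add.
Qed.

Lemma smooth_gen_regular V (A : set V) (f : V -> R) : open A -> smooth_gen A f ->
  (forall x, A x -> {for x, continuous f} /\ forall v, derivable f x v) /\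
  forall v, exists2 g, smooth_gen A g & forall x, A x -> 'D_v f x = g x.
Proof.
move=> oA; elim=> {f}.
- move=> f sf; split=> [x Ax|v].
    by split=> [|v]; [exact: smooth_on_continuous sf Ax|exact: smooth_on_derivable sf Ax].
  by exists ('D_v f); [apply: sg_smooth; exact: smooth_on_derive|].
- move=> f g _ [rf df] _ [rg dg]; split=> [x Ax|v].
    have [cf {}df] := rf x Ax; have [cg {}dg] := rg x Ax.
    by split=> [|v]; [exact: continuousD cf cg|exact: derivableD].
  have [f' sf' ff'] := df v; have [g' sg' gg'] := dg v.
  exists (fun x => f' x + g' x); first exact: sg_add.
  move=> x Ax; rewrite -ff' // -gg' //; apply: deriveD.
    exact: (rf x Ax).2.
  exact: (rg x Ax).2.
- move=> f g gf [rf df] gg [rg dg]; split=> [x Ax|v].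
    have [cf {}df] := rf x Ax; have [cg {}dg] := rg x Ax.
    by split=> [|v]; [exact: continuousM cf cg|exact: derivableM].
  have [f' sf' ff'] := df v; have [g' sg' gg'] := dg v.
  exists (fun x => f x * g' x + g x * f' x); first by apply: sg_add; exact: sg_mul.
  move=> x Ax; rewrite -ff' // -gg' //; apply: deriveM.
    exact: (rf x Ax).2.
  exact: (rg x Ax).2.
- move=> f gf [rf df] f0; split=> [x Ax|v].
    have [cf {}df] := rf x Ax.
    by split=> [|v]; [exact: cvgV (f0 x Ax) cf|exact: derivableV (f0 x Ax) (df v)].
  have [f' sf' ff'] := df v.
  exists (fun x => (-1) * ((f x)^-1 * ((f x)^-1 * f' x))).
    apply: sg_mul; first by apply: sg_smooth; exact: smooth_on_cst.
    by apply: sg_mul; [exact: sg_inv|apply: sg_mul => //; exact: sg_inv].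
  move=> x Ax; rewrite -ff' // deriveV; [|exact: f0|exact: (rf x Ax).2].
  by rewrite mulN1r scaleNr -exprVn expr2 mulrA.
- move=> a f gf [rf df] f0.
  have dp x v : A x -> is_derive x v (fun x => f x `^ a)
      ('D_v f x * (a * f x `^ (a - 1))).
    by move=> Ax; apply: is_derive_powR_comp; [exact: (rf x Ax).2|exact: f0].
  split=> [x Ax|v].
    split=> [|v]; last exact: (@ex_derive _ _ _ _ _ _ _ (dp x v Ax)).
    have [cf _] := rf x Ax.
    have pd := is_derive1_powR a (f0 x Ax).
    have /derivable1_diffP/differentiable_continuous pc : derivable (fun y : R => y `^ a) (f x) 1.
      exact: (@ex_derive _ _ _ _ _ _ _ pd).
    exact: (continuous_comp cf pc).
  have [f' sf' ff'] := df v.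
  exists (fun x => f' x * (a * f x `^ (a - 1))).
    apply: sg_mul => //; apply: sg_mul; first by apply: sg_smooth; exact: smooth_on_cst.
    exact: sg_powR.
  by move=> x Ax; rewrite -ff' //; exact: (@derive_val _ _ _ _ _ _ _ (dp x v Ax)).
- move=> n B h phi oB sh AB gphi IH.
  have phic x : A x -> {for x, continuous phi}.
    by move=> Ax; apply: continuous_rV => i; exact: ((IH i).1 x Ax).1.
  have phid x v : A x -> derivable phi x v.
    move=> Ax; apply: (derivable_mxP phi x v).2 => i j; rewrite [i]ord1.
    exact: ((IH j).1 x Ax).2.
  have hd y : B y -> differentiable h y /\
      forall v, 'd h y v = \sum_i v 0 i * 'D_(delta_mx 0 i) h y.
    move=> By; apply: differentiable_of_partials.
      apply: filterS (open_nbhs_nbhs (conj oB By)) => z Bz i.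
      exact: smooth_on_derivable sh Bz.
    by move=> i; apply: smooth_on_continuous By; exact: smooth_on_derive.
  have chain x v (Ax : A x) := derive_comp_partials (hd _ (AB x Ax)).1
    (hd _ (AB x Ax)).2 (phid x v Ax).
  split=> [x Ax|v].
    split=> [|v]; last exact: (chain x v Ax).1.
    exact: (continuous_comp (phic x Ax) (smooth_on_continuous sh (AB x Ax))).
  have [g hg] : {g : 'I_n -> V -> R & forall i, smooth_gen A (g i) /\
      forall x, A x -> 'D_v (fun x => phi x 0 i) x = g i x}.
    apply: (@choice _ _ (fun i g => smooth_gen A g /\
      forall x, A x -> 'D_v (fun x => phi x 0 i) x = g x)) => i.
    by have [g sg Eg] := (IH i).2 v; exists g.
  exists (fun x => \sum_i g i x * ('D_(delta_mx 0 i) h \o phi) x).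
    apply: smooth_gen_sum => // i; apply: sg_mul; first exact: (hg i).1.
    exact: (sg_comp oB (smooth_on_derive _ sh) AB gphi).
  move=> x Ax; rewrite (chain x v Ax).2; apply: eq_bigr => i _.
  by rewrite (hg i).2.
Qed.

Lemma smooth_genP V (A : set V) (f : V -> R) : open A ->
  smooth_gen A f -> smooth_on A f.
Proof.
move=> oA gf; apply: (@smooth_on_coind _ _ A (smooth_gen A) oA) => //.
  by move=> {gf} f gf; exact: (smooth_gen_regular oA gf).1.
by move=> {gf} f v gf; exact: (smooth_gen_regular oA gf).2.
Qed.

Lemma is_derive_slice V V' W (f : V -> W) (L : {linear V' -> V}) (a : V) (y v : V') :
  derivable f (a + L y) (L v) ->
  is_derive y v (fun y => f (a + L y)) ('D_(L v) f (a + L y)).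
Proof.
have E : (fun h : R => h^-1 *: (f (a + L (h *: v + y)) - f (a + L y)))
   = (fun h => h^-1 *: (f (h *: L v + (a + L y)) - f (a + L y))).
  by apply/funext => h; rewrite linearP addrCA.
move=> df; apply: DeriveDef; first by rewrite /derivable /= E.
by rewrite /derive /= E.
Qed.

(** A derivative of the slice along v is the slice of the derivative along L v, so slices form a
    class to which [smooth_on_coind] applies. *)
Lemma smooth_on_slice V V' W (A : set V) (B : set V') (f : V -> W)
    (L : {linear V' -> V}) (a : V) : open B -> continuous L ->
  smooth_on A f -> (forall y, B y -> A (a + L y)) ->
  smooth_on B (fun y => f (a + L y)).
Proof.
move=> oB cL sf BA; apply: (@smooth_on_coind _ _ B
  (fun g => exists2 f, smooth_on A f & g = fun y => f (a + L y))) => //.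
- move=> {f sf} _ [f sf ->] y By; split.
    apply: (@continuous_comp _ _ _ (fun y => a + L y) f).
      by apply: cvgD; [exact: cvg_cst|exact: cL].
    exact: smooth_on_continuous sf (BA y By).
  move=> v; have := is_derive_slice (smooth_on_derivable (L v) sf (BA y By)).
  by move=> d; exact: (@ex_derive _ _ _ _ _ _ _ d).
- move=> {f sf} _ v [f sf ->]; exists (fun y => 'D_(L v) f (a + L y)).
    by exists ('D_(L v) f); [exact: smooth_on_derive|].
  move=> y By; have d := is_derive_slice (smooth_on_derivable (L v) sf (BA y By)).
  exact: (@derive_val _ _ _ _ _ _ _ d).
- by exists f.
Qed.

Lemma smooth_on_derive_comm V (A : set V) (f : V -> R) (x v w : V) : open A ->
  smooth_on A f -> A x -> 'D_w ('D_v f) x = 'D_v ('D_w f) x.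
Proof.
move=> oA sf Ax; have n := open_nbhs_nbhs (conj oA Ax).
apply: derive_comm.
- by apply: filterS n => y Ay; split; exact: smooth_on_derivable sf Ay.
- by apply: filterS n => y Ay; split; apply: smooth_on_derivable Ay; exact: smooth_on_derive.
- by apply: smooth_on_continuous Ax; do 2 apply: smooth_on_derive.
- by apply: smooth_on_continuous Ax; do 2 apply: smooth_on_derive.
Qed.

End SmoothOn.

(** * The ring of functions smooth on an open set *)

(* The point [reg_pt] makes the ring of smooth functions nontrivial. *)
Record region (R : realType) (n : nat) := Region {
  reg_set : set 'rV[R]_n;
  reg_open : open reg_set;
  reg_pt : 'rV[R]_n;
  reg_ptP : reg_set reg_pt
}.
Arguments reg_open {R n} r.

Section SmoothRing.
Variables (R : realType) (n : nat).
Variable D : region R n.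
Notation A := (reg_set D).

(* Functions smooth on [A] are represented by their extension by zero, so that
   equality in the ring is equality on [A]. *)
Record smooth_ring := SmoothRing {
  sr_val :> 'rV[R]_n -> R;
  sr_prop : `[< smooth_on A sr_val /\ forall x, ~ A x -> sr_val x = 0 >]
}.

HB.instance Definition _ := [isSub for sr_val].
HB.instance Definition _ := [Choice of smooth_ring by <:].

Lemma sr_smooth (f : smooth_ring) : smooth_on A f.
Proof. by have /asboolP[] := sr_prop f. Qed.

Lemma sr_eq (f g : smooth_ring) : (forall x, A x -> f x = g x) -> f = g.
Proof.
move=> fg; apply: val_inj; apply/funext => x /=.
have [Ax|nAx] := pselect (A x); first exact: fg.
have /asboolP[_ f0] := sr_prop f; have /asboolP[_ g0] := sr_prop g.
by rewrite f0 // g0.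
Qed.

Definition sr_cut (f : 'rV[R]_n -> R) : 'rV[R]_n -> R :=
  fun x => if `[< A x >] then f x else 0.

Lemma sr_cutE f x : A x -> sr_cut f x = f x.
Proof. by move=> Ax; rewrite /sr_cut asboolT. Qed.

Lemma sr_cut_prop f : smooth_gen A f ->
  `[< smooth_on A (sr_cut f) /\ forall x, ~ A x -> sr_cut f x = 0 >].
Proof.
move=> sf; apply/asboolP; split; last by move=> x nAx; rewrite /sr_cut asboolF.
refine (smooth_on_eq (reg_open D) _ (smooth_genP (reg_open D) sf)).
by move=> x Ax; rewrite sr_cutE.
Qed.

Definition sr_mk f (sf : smooth_gen A f) : smooth_ring := SmoothRing (sr_cut_prop sf).

Lemma sr_mkE f (sf : smooth_gen A f) x : A x -> sr_mk sf x = f x.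
Proof. exact: sr_cutE. Qed.

Lemma sr_gen (f : smooth_ring) : smooth_gen A f.
Proof. exact/sg_smooth/sr_smooth. Qed.

Definition sr_const (c : R) : smooth_ring :=
  sr_mk (sg_smooth (smooth_on_cst (V := 'rV[R]_n) (W := R) c (reg_open D))).
Definition sr_add (f g : smooth_ring) : smooth_ring := sr_mk (sg_add (sr_gen f) (sr_gen g)).
Definition sr_mul (f g : smooth_ring) : smooth_ring := sr_mk (sg_mul (sr_gen f) (sr_gen g)).
Definition sr_opp (f : smooth_ring) : smooth_ring := sr_mul (sr_const (-1)) f.

Lemma sr_addA : associative sr_add.
Proof. by move=> f g h; apply: sr_eq => x Ax; rewrite !sr_mkE // addrA. Qed.

Lemma sr_addC : commutative sr_add.
Proof. by move=> f g; apply: sr_eq => x Ax; rewrite !sr_mkE // addrC. Qed.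

Lemma sr_add0 : left_id (sr_const 0) sr_add.
Proof. by move=> f; apply: sr_eq => x Ax; rewrite !sr_mkE // add0r. Qed.

Lemma sr_addN : left_inverse (sr_const 0) sr_opp sr_add.
Proof. by move=> f; apply: sr_eq => x Ax; rewrite !sr_mkE // mulN1r addNr. Qed.

HB.instance Definition _ := GRing.isZmodule.Build smooth_ring sr_addA sr_addC sr_add0 sr_addN.

Lemma sr_mulA : associative sr_mul.
Proof. by move=> f g h; apply: sr_eq => x Ax; rewrite !sr_mkE // mulrA. Qed.

Lemma sr_mulC : commutative sr_mul.
Proof. by move=> f g; apply: sr_eq => x Ax; rewrite !sr_mkE // mulrC. Qed.

Lemma sr_mul1 : left_id (sr_const 1) sr_mul.
Proof. by move=> f; apply: sr_eq => x Ax; rewrite !sr_mkE // mul1r. Qed.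

Lemma sr_mulDl : left_distributive sr_mul sr_add.
Proof. by move=> f g h; apply: sr_eq => x Ax; rewrite !sr_mkE // mulrDl. Qed.

Lemma sr_1_neq0 : sr_const 1 != sr_const 0.
Proof.
apply/eqP => /(congr1 (fun f : smooth_ring => f (reg_pt D))).
by rewrite !sr_mkE; [move=> /eqP; rewrite oner_eq0|exact: reg_ptP|exact: reg_ptP].
Qed.

HB.instance Definition _ := GRing.Zmodule_isComNzRing.Build smooth_ring
  sr_mulA sr_mulC sr_mul1 sr_mulDl sr_1_neq0.

Section Eval.
Variables (y : 'rV[R]_n) (Ay : A y).

(** The membership proof is an argument because evaluation outside [A] sends 1 to 0 and so is not a
    ring morphism. *)
Definition sr_ev of A y := fun f : smooth_ring => f y.

Lemma sr_ev_zmod : zmod_morphism (sr_ev Ay).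
Proof. by move=> f g; rewrite /sr_ev !sr_mkE // mulN1r. Qed.

Lemma sr_ev_monoid : monoid_morphism (sr_ev Ay).
Proof. by split=> [|f g]; rewrite /sr_ev !sr_mkE. Qed.

HB.instance Definition _ := GRing.isZmodMorphism.Build _ _ (sr_ev Ay) sr_ev_zmod.
HB.instance Definition _ := GRing.isMonoidMorphism.Build _ _ (sr_ev Ay) sr_ev_monoid.

Lemma sr_evE f : sr_ev Ay f = f y. Proof. by []. Qed.

End Eval.

Definition sr_der (v : 'rV[R]_n) (f : smooth_ring) : smooth_ring :=
  sr_mk (sg_smooth (smooth_on_derive v (sr_smooth f))).

Lemma sr_derE v (f : smooth_ring) (g : 'rV[R]_n -> R) x :
  (forall y, A y -> f y = g y) -> A x -> sr_der v f x = 'D_v g x.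
Proof.
move=> fg Ax; rewrite sr_mkE //; apply: near_eq_derive.
exact: (open_near_eq (reg_open D) Ax fg).
Qed.

Lemma sr_derD v f g : sr_der v (f + g) = sr_der v f + sr_der v g.
Proof.
apply: sr_eq => x Ax; rewrite [RHS]sr_mkE //.
rewrite (@sr_derE v _ (fun x => f x + g x)) //; last by move=> y Ay; rewrite sr_mkE.
rewrite !sr_mkE //; apply: deriveD; exact: smooth_on_derivable (sr_smooth _) Ax.
Qed.

Lemma sr_derM v f g : sr_der v (f * g) = sr_der v f * g + f * sr_der v g.
Proof.
apply: sr_eq => x Ax.
rewrite (@sr_derE v _ (fun x => f x * g x)) //; last by move=> y Ay; rewrite sr_mkE.
transitivity (f x * 'D_v g x + g x * 'D_v f x).
  by apply: deriveM; exact: smooth_on_derivable (sr_smooth _) Ax.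
rewrite [RHS]sr_mkE // [in RHS](sr_mkE _ Ax) [in RHS](sr_mkE _ Ax).
rewrite [in RHS](sr_mkE _ Ax) [in RHS](sr_mkE _ Ax) addrC.
by congr (_ + _); exact: mulrC.
Qed.

Lemma sr_derC v w f : sr_der v (sr_der w f) = sr_der w (sr_der v f).
Proof.
apply: sr_eq => x Ax.
have E a b : sr_der a (sr_der b f) x = 'D_a ('D_b f) x.
  by apply: sr_derE Ax => y Ay; exact: sr_mkE.
refine (etrans (E v w) (etrans _ (esym (E w v)))).
exact: smooth_on_derive_comm (reg_open D) (sr_smooth f) Ax.
Qed.

Lemma sr_der_const v c : sr_der v (sr_const c) = 0.
Proof.
apply: sr_eq => x Ax; rewrite [RHS]sr_mkE //.
rewrite (@sr_derE v _ (fun=> c)) //; last by move=> y Ay; rewrite sr_mkE.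
exact: derive_cst.
Qed.

End SmoothRing.
Arguments sr_val {R n D} _ _ : simpl never.
Arguments sr_ev {R n D y} _ _ : simpl never.

(** * Coordinate geometry inside the ring of smooth functions *)

Record metric_on (R : realType) (n : nat) (A : set 'rV[R]_n) (G : 'rV[R]_n -> 'M[R]_n) : Prop :=
  MetricOn {
  mo_smooth : smooth_on A G;
  mo_sym : forall y, A y -> (G y)^T = G y;
  mo_pos : forall y (v : 'rV[R]_n), A y -> v != 0 -> 0 < (v *m G y *m v^T) 0 0
}.

Section LocalGeometry.
Variables (R : realType) (n : nat) (D : region R n) (G : 'rV[R]_n -> 'M[R]_n).
Notation A := (reg_set D).
Notation T := (smooth_ring D).
Hypothesis mG : metric_on A G.

Definition sr_d (i : 'I_n) : T -> T := sr_der (delta_mx 0 i).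

Definition sr_metric : 'M[T]_n :=
  \matrix_(i, j) sr_mk (sg_smooth (smooth_on_mx i j (reg_open D) (mo_smooth mG))).

Lemma sr_metricE y (Ay : A y) : map_mx (sr_ev Ay) sr_metric = G y.
Proof. by apply/matrixP => i j; rewrite !mxE sr_evE sr_mkE. Qed.

Lemma sr_det_neq0 y : A y -> (\det sr_metric : T) y != 0.
Proof.
move=> Ay; rewrite -(sr_evE Ay) -det_map_mx sr_metricE -unitfE -unitmxE.
by apply: posdef_unit => v; exact: mo_pos mG y v Ay.
Qed.

Definition sr_det_inv : T := sr_mk (sg_inv (sr_gen (\det sr_metric : T)) sr_det_neq0).

(** Cramer's formula keeps the entries of the inverse metric inside the ring; only the determinant
    has to be inverted. *)
Definition sr_cometric : 'M[T]_n := sr_det_inv *: \adj sr_metric.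

Lemma sr_cometricK : sr_cometric *m sr_metric = 1%:M.
Proof.
rewrite -scalemxAl mul_adj_mx scale_scalar_mx; congr _%:M.
apply: sr_eq => y Ay; rewrite -!(sr_evE Ay) rmorphM rmorph1 /= !sr_evE.
by rewrite [X in X * _](sr_mkE _ Ay) mulVf // sr_det_neq0.
Qed.

Lemma sr_cometricE y (Ay : A y) : map_mx (sr_ev Ay) sr_cometric = invmx (G y).
Proof.
have E : map_mx (sr_ev Ay) sr_cometric *m G y = 1%:M.
  by rewrite -(sr_metricE Ay) -map_mxM sr_cometricK map_mx1.
have /mulmx1_unit[_ Gu] := E.
by rewrite -[LHS]mulmx1 -(mulmxV Gu) mulmxA E mul1mx.
Qed.

Lemma sr_metricData :
  metricData sr_d sr_metric sr_cometric (sr_const D 2^-1).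
Proof.
split.
- by move=> i; exact: sr_derD.
- by move=> i; exact: sr_derM.
- by move=> i j; exact: sr_derC.
- by apply/matrixP => i j; rewrite !mxE; apply: sr_eq => y Ay;
    rewrite !sr_mkE // -{1}(mo_sym mG Ay) mxE.
- exact: sr_cometricK.
- apply: sr_eq => y Ay; rewrite -!(sr_evE Ay) rmorphD rmorph1 /= sr_evE sr_mkE //.
  by rewrite [RHS]splitr mul1r.
Qed.

Lemma partialE i (f : T) (u : 'rV[R]_n -> R) y :
  (forall z, A z -> u z = f z) -> A y -> partial i u y = sr_d i f y.
Proof. by move=> uf Ay; apply/esym/sr_derE => // z Az; rewrite uf. Qed.

Lemma sr_cometric_at y (Ay : A y) i j : sr_cometric i j y = invmx (G y) i j.
Proof. by rewrite -(sr_cometricE Ay) [RHS]mxE. Qed.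

Lemma sr_metric_at y (Ay : A y) i j : sr_metric i j y = G y i j.
Proof. by rewrite -(sr_metricE Ay) [RHS]mxE. Qed.

Notation Gam := (ag_christoffel sr_d sr_metric sr_cometric (sr_const D 2^-1)).
Notation grad := (ag_grad sr_d sr_cometric).
Notation cov := (ag_cov sr_d sr_metric sr_cometric (sr_const D 2^-1)).
Notation lap := (ag_lap sr_d sr_metric sr_cometric (sr_const D 2^-1)).

Lemma christoffelE k i j y : A y -> christoffel G k i j y = Gam k i j y.
Proof.
move=> Ay; rewrite -[RHS](sr_evE Ay) rmorphM rmorph_sum /= sr_evE sr_mkE //.
congr (_ * _); apply: eq_bigr => l _.
rewrite rmorphM rmorphB rmorphD /= !sr_evE (sr_cometric_at Ay).
have E a b c : partial a (fun z => G z b c) y = sr_d a (sr_metric b c) y.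
  by apply: partialE => // z Az; rewrite sr_metric_at.
by rewrite !E.
Qed.

Lemma gradientE (u : 'rV[R]_n -> R) (f : T) i y :
  (forall z, A z -> u z = f z) -> A y -> gradient G u y 0 i = grad f i y.
Proof.
move=> uf Ay; rewrite mxE -[RHS](sr_evE Ay) rmorph_sum; apply: eq_bigr => j _.
rewrite rmorphM /= !sr_evE (sr_cometric_at Ay); congr (_ * _).
exact: partialE.
Qed.

Lemma divergenceE (X : 'rV[R]_n -> 'rV[R]_n) (Y : 'I_n -> T) y :
  (forall z i, A z -> X z 0 i = Y i z) -> A y ->
  divergence G X y = (\sum_i cov Y i i : T) y.
Proof.
move=> XY Ay; rewrite -[RHS](sr_evE Ay) rmorph_sum; apply: eq_bigr => i _.
rewrite rmorphD rmorph_sum /= !sr_evE; congr (_ + _).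
  by apply: partialE => // z Az; rewrite XY.
by apply: eq_bigr => j _; rewrite rmorphM /= !sr_evE christoffelE // XY.
Qed.

Lemma local_laplacianE (u : 'rV[R]_n -> R) (f : T) y :
  (forall z, A z -> u z = f z) -> A y -> local_laplacian G u y = lap f y.
Proof.
by move=> uf Ay; apply: divergenceE => // z i Az; exact: gradientE.
Qed.

Lemma ricciE j k y : A y ->
  ricci G y j k = ag_ricci sr_d sr_metric sr_cometric (sr_const D 2^-1) j k y.
Proof.
move=> Ay; rewrite mxE -[RHS](sr_evE Ay) rmorph_sum; apply: eq_bigr => i _.
rewrite rmorphD rmorphB rmorph_sum /= !sr_evE /riemann.
have E a b c d : partial a (christoffel G b c d) y = sr_d a (Gam b c d) y.
  by apply: partialE => // z Az; rewrite christoffelE.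
rewrite !E; congr (_ + _); apply: eq_bigr => p _.
by rewrite rmorphB; congr (_ - _); rewrite rmorphM /= !sr_evE !christoffelE.
Qed.

End LocalGeometry.

Lemma smooth_on_id (R : realType) (V : normedModType R) (A : set V) :
  open A -> smooth_on A (id : V -> V).
Proof.
move=> oA; apply: (@smooth_on_coind _ _ _ A
  (fun f => f = id \/ exists c, f = fun=> c)) => //; last by left.
- move=> f [->|[c ->]] x _; split.
  + by move=> B nB; exact: nB.
  + by move=> v; exact: derivable_id.
  + exact: cst_continuous.
  + by move=> v; exact: derivable_cst.
- move=> f v [->|[c ->]].
    by exists (fun=> v); [right; exists v|move=> x _; exact: derive_id].
  by exists (fun=> 0); [right; exists 0|move=> x _; exact: derive_cst].
Qed.

(** * Pull-back along a change of coordinates *)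

Section CoordinateChange.
Variables (R : realType) (n : nat) (D D' : region R n).
Variables (G G' : 'rV[R]_n -> 'M[R]_n) (phi : 'rV[R]_n -> 'rV[R]_n).
Notation A := (reg_set D).
Notation A' := (reg_set D').
Notation T := (smooth_ring D).
Notation T' := (smooth_ring D').
Hypothesis mG : metric_on A G.
Hypothesis mG' : metric_on A' G'.
Hypothesis phi_smooth : smooth_on A phi.
Hypothesis phi_maps : forall y, A y -> A' (phi y).
Hypothesis phi_metric : forall y (v w : 'rV[R]_n), A y ->
  v *m G y *m w^T = 'D_v phi y *m G' (phi y) *m ('D_w phi y)^T.

Definition sr_pull (f : T') : T :=
  sr_mk (sg_comp (reg_open D') (sr_smooth f) phi_maps
    (fun i => sg_smooth (smooth_on_mx 0 i (reg_open D) phi_smooth))).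

Lemma sr_pullE f y : A y -> sr_pull f y = f (phi y).
Proof. by move=> Ay; rewrite sr_mkE. Qed.

Lemma sr_pull_zmod : zmod_morphism sr_pull.
Proof.
move=> f g; apply: sr_eq => y Ay; rewrite sr_pullE //.
rewrite -(sr_evE (phi_maps Ay)) -[RHS](sr_evE Ay) !rmorphB /= !sr_evE.
by rewrite !sr_pullE.
Qed.

Lemma sr_pull_monoid : monoid_morphism sr_pull.
Proof.
split=> [|f g]; apply: sr_eq => y Ay; rewrite sr_pullE //.
  by rewrite -(sr_evE (phi_maps Ay)) -[RHS](sr_evE Ay) !rmorph1.
rewrite -(sr_evE (phi_maps Ay)) -[RHS](sr_evE Ay) !rmorphM /= !sr_evE.
by rewrite !sr_pullE.
Qed.

HB.instance Definition _ := GRing.isZmodMorphism.Build _ _ sr_pull sr_pull_zmod.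
HB.instance Definition _ := GRing.isMonoidMorphism.Build _ _ sr_pull sr_pull_monoid.

Definition sr_jacobian : 'M[T]_n := \matrix_(i, a)
  sr_mk (sg_smooth (smooth_on_mx 0 a (reg_open D)
    (smooth_on_derive (delta_mx 0 i) phi_smooth))).

Lemma sr_jacobianE i a y : A y -> sr_jacobian i a y = 'D_(delta_mx 0 i) phi y 0 a.
Proof. by move=> Ay; rewrite mxE sr_mkE. Qed.

Definition sr_coord (p : 'I_n) : T' :=
  sr_mk (sg_smooth (smooth_on_mx 0 p (reg_open D') (smooth_on_id (reg_open D')))).

Lemma sr_d_coord a p : sr_d a (sr_coord p) = (a == p)%:R.
Proof.
apply: sr_eq => y Ay; rewrite -[RHS](sr_evE Ay) rmorph_nat.
have -> : sr_d a (sr_coord p) y = 'D_(delta_mx 0 a) (fun x : 'rV[R]_n => x 0 p) y.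
  by apply: sr_derE Ay => z Az; exact: sr_mkE.
have idd : derivable (id : 'rV[R]_n -> 'rV[R]_n) y (delta_mx 0 a).
  exact: derivable_id.
have := derive_mx idd; rewrite derive_id => /matrixP/(_ 0 p).
by rewrite !mxE eqxx eq_sym => <-.
Qed.

Lemma sr_pull_metric :
  sr_metric mG = sr_jacobian *m map_mx sr_pull (sr_metric mG') *m sr_jacobian^T.
Proof.
apply/matrixP => i j; apply: sr_eq => y Ay; rewrite sr_metric_at //.
have := congr1 (fun M : 'M[R]_1 => M 0 0)
  (@phi_metric y (delta_mx 0 i) (delta_mx 0 j) Ay).
rewrite /= -rowE trmx_delta -colE !mxE => ->.
rewrite -[RHS](sr_evE Ay) rmorph_sum; apply: eq_bigr => a _.
rewrite rmorphM /= !sr_evE [sr_jacobian^T _ _]mxE sr_jacobianE // !mxE; congr (_ * _).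
rewrite -[RHS](sr_evE Ay) rmorph_sum; apply: eq_bigr => b _.
rewrite rmorphM /= !sr_evE sr_jacobianE // [map_mx _ _ _ _]mxE sr_pullE //.
by rewrite sr_metric_at //; exact: phi_maps.
Qed.

Lemma sr_d_pull i f : sr_d i (sr_pull f) = \sum_a sr_jacobian i a * sr_pull (sr_d a f).
Proof.
apply: sr_eq => y Ay.
have fd : differentiable f (phi y) /\
    forall v, 'd f (phi y) v = \sum_i v 0 i * 'D_(delta_mx 0 i) f (phi y).
  apply: differentiable_of_partials.
    apply: filterS (open_nbhs_nbhs (conj (reg_open D') (phi_maps Ay))) => z Bz j.
    exact: smooth_on_derivable (sr_smooth f) Bz.
  move=> j; apply: smooth_on_continuous (phi_maps Ay).
  exact: smooth_on_derive (sr_smooth f).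
have phid : derivable phi y (delta_mx 0 i) := smooth_on_derivable phi_smooth Ay.
have [_ chain] := derive_comp_partials fd.1 fd.2 phid.
have -> : sr_d i (sr_pull f) y = 'D_(delta_mx 0 i) (f \o phi) y.
  by apply: sr_derE Ay => z Az; exact: sr_pullE.
rewrite chain -[RHS](sr_evE Ay) rmorph_sum; apply: eq_bigr => a _.
rewrite rmorphM /= !sr_evE sr_jacobianE // sr_pullE // (derive_mx phid) mxE.
congr (_ * _); apply/esym/sr_mkE; exact: phi_maps.
Qed.

Lemma local_laplacian_change (u : 'rV[R]_n -> R) y : smooth_on A' u -> A y ->
  local_laplacian G (u \o phi) y = local_laplacian G' u (phi y).
Proof.
move=> su Ay; pose f : T' := sr_mk (sg_smooth su).
have uf z : A' z -> u z = f z by move=> Az; rewrite sr_mkE.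
rewrite (local_laplacianE mG' uf (phi_maps Ay)).
rewrite (@local_laplacianE _ _ _ _ mG _ (sr_pull f)) //; last first.
  by move=> z Az; rewrite sr_pullE // -uf //; exact: phi_maps.
rewrite -(ag_lap_change (sr_metricData mG) (sr_metricData mG') sr_d_pull
  sr_pull_metric sr_d_coord).
exact: sr_pullE.
Qed.

End CoordinateChange.

(** * The Laplacian on time slices *)

Section Slices.
Variables (R : realType) (V : normedModType R).
Notation E := (R * V)%type.

Definition time_inj (s : R) : E := (s, 0).
Definition space_inj (y : V) : E := (0, y).

Lemma time_inj_linear : linear time_inj.
Proof. by move=> a u v; rewrite /time_inj; congr pair; rewrite /= scaler0 addr0. Qed.
Lemma space_inj_linear : linear space_inj.
Proof. by move=> a u v; rewrite /space_inj; congr pair; rewrite /= scaler0 addr0. Qed.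

HB.instance Definition _ := GRing.isLinear.Build _ _ _ _ time_inj time_inj_linear.
HB.instance Definition _ := GRing.isLinear.Build _ _ _ _ space_inj space_inj_linear.

Lemma pair_l_continuous (y : V) : continuous (fun s : R => (s, y) : E).
Proof.
move=> s; apply: differentiable_continuous; apply: differentiable_pair.
  exact: ex_diff.
exact: differentiable_cst.
Qed.

Lemma pair_r_continuous (s : R) : continuous (fun y : V => (s, y) : E).
Proof.
move=> y; apply: differentiable_continuous; apply: differentiable_pair.
  exact: differentiable_cst.
exact: ex_diff.
Qed.

Lemma space_slice (W : Type) (F : E -> W) s :
  (fun y => F (s, y)) = (fun y => F (time_inj s + space_inj y)).
Proof. by apply/funext => y; congr F; congr pair; rewrite ?addr0 ?add0r. Qed.

Lemma time_slice (W : Type) (F : E -> W) y :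
  (fun s => F (s, y)) = (fun s => F (space_inj y + time_inj s)).
Proof. by apply/funext => s; congr F; congr pair; rewrite ?addr0 ?add0r. Qed.

Lemma pair_slice s y : (s, y) = time_inj s + space_inj y.
Proof. by congr pair; rewrite ?addr0 ?add0r. Qed.

Lemma is_derive_space_slice (F : E -> R) s y v : derivable F (s, y) (0, v) ->
  is_derive y v (fun y => F (s, y)) ('D_(0, v) F (s, y)).
Proof. by rewrite space_slice pair_slice => d; exact: (is_derive_slice d). Qed.

Lemma is_derive_time_slice (F : E -> R) (s : R) y : derivable F (s, y) (1, 0) ->
  is_derive s 1 (fun s => F (s, y)) ('D_(1, 0) F (s, y)).
Proof.
by rewrite time_slice pair_slice addrC => d; exact: (is_derive_slice d).
Qed.

Lemma smooth_on_space_slice (O : set E) (B : set V) (F : E -> R) s :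
  open B -> smooth_on O F -> (forall y, B y -> O (s, y)) ->
  smooth_on B (fun y => F (s, y)).
Proof.
move=> oB sF BO; rewrite space_slice.
refine (@smooth_on_slice R _ _ _ O B F space_inj (time_inj s) oB (@pair_r_continuous 0) sF _).
move=> y By.
by rewrite -pair_slice; exact: BO.
Qed.

Lemma open_space_slice (O : set E) s : open O -> open [set y | O (s, y)].
Proof.
move=> oO; have := @open_comp _ _ (fun y : V => (s, y)) O.
by apply => // y _; exact: pair_r_continuous.
Qed.

End Slices.

Section SpacetimeLaplacian.
Variables (R : realType) (n : nat).
Notation E := (R * 'rV[R]_n)%type.
Variables (A : set 'rV[R]_n) (G : 'rV[R]_n -> 'M[R]_n).
Hypothesis oA : open A.
Hypothesis mG : metric_on A G.

Definition dir (i : 'I_n) : E := (0, delta_mx 0 i).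

(** The trace of the Hessian of a time slice, written with derivatives of [F] on space-time: joint
    continuity and time derivatives are then read off from smoothness of [F]. *)
Definition slice_laplacian (F : E -> R) (p : E) : R :=
  \sum_k \sum_l invmx (G p.2) k l *
    ('D_(dir k) ('D_(dir l) F) p - \sum_q christoffel G q k l p.2 * 'D_(dir q) F p).

Lemma local_laplacian_expand (B : set 'rV[R]_n) (u : 'rV[R]_n -> R) y :
  open B -> smooth_on B u -> A y -> B y ->
  local_laplacian G u y = \sum_k \sum_l invmx (G y) k l *
    (partial k (partial l u) y - \sum_q christoffel G q k l y * partial q u y).
Proof.
move=> oB su Ay By; pose D := Region (openI oA oB) (conj Ay By).
have mD : metric_on (reg_set D) G.
  split.
  - exact (@smooth_on_subset _ _ _ A (A `&` B) G (fun z Dz => Dz.1) (mo_smooth mG)).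
  - by move=> z [Az _]; exact: mo_sym mG z Az.
  - by move=> z v [Az _]; exact: mo_pos mG z v Az.
have suD : smooth_on (reg_set D) u.
  exact (@smooth_on_subset _ _ _ B (A `&` B) u (fun z Dz => Dz.2) su).
pose f : smooth_ring D := sr_mk (sg_smooth suD).
have uf z : reg_set D z -> u z = f z by move=> Dz; rewrite sr_mkE.
have Dy : reg_set D y by split.
rewrite (local_laplacianE mD uf Dy) (ag_lapE (sr_metricData mD)).
rewrite -(sr_evE Dy) rmorph_sum; apply: eq_bigr => k _.
rewrite rmorph_sum; apply: eq_bigr => l _.
rewrite rmorphM rmorphB rmorph_sum /= !sr_evE (sr_cometric_at mD Dy).
congr (_ * (_ - _)).
  by apply/esym; apply: partialE => // z Dz; exact: partialE.
apply: eq_bigr => q _; rewrite rmorphM /= !sr_evE (christoffelE mD) //.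
by congr (_ * _); apply/esym; exact: partialE.
Qed.

Variables (O : set E) (F : E -> R).
Hypothesis oO : open O.
Hypothesis sF : smooth_on O F.

Lemma slice_laplacianE s y : O (s, y) -> A y ->
  local_laplacian G (fun z => F (s, z)) y = slice_laplacian F (s, y).
Proof.
move=> Osy Ay; pose B := [set z | O (s, z)].
have oB : open B := open_space_slice s oO.
have sFs : smooth_on B (fun z => F (s, z)) by apply: smooth_on_space_slice oB sF _ => z.
have P i z : B z -> partial i (fun z => F (s, z)) z = 'D_(dir i) F (s, z).
  move=> Bz; have d := is_derive_space_slice (smooth_on_derivable sF Bz : derivable F (s, z) (0, delta_mx 0 i)).
  exact: (@derive_val _ _ _ _ _ _ _ d).
have P2 k l : partial k (partial l (fun z => F (s, z))) y = 'D_(dir k) ('D_(dir l) F) (s, y).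
  have d := is_derive_space_slice (smooth_on_derivable (smooth_on_derive (dir l) sF) Osy
    : derivable ('D_(dir l) F) (s, y) (0, delta_mx 0 k)).
  rewrite -(@derive_val _ _ _ _ _ _ _ d); apply: near_eq_derive.
  exact: (open_near_eq oB Osy (P l)).
rewrite (local_laplacian_expand oB sFs Ay Osy); apply: eq_bigr => k _; apply: eq_bigr => l _.
by rewrite P2; congr (_ * (_ - _)); apply: eq_bigr => q _; rewrite P.
Qed.

End SpacetimeLaplacian.

Lemma continuous_sum_at (R : realType) (T : topologicalType) n (f : 'I_n -> T -> R) (x : T) :
  (forall i, {for x, continuous (f i)}) -> {for x, continuous (fun y => \sum_i f i y)}.
Proof.
move=> cf; apply: (@cvg_big _ _ +%R 0 xpredT add_continuous T (nbhs x) (index_enum _) f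
  (fun i => f i x)) => i _; exact: cf.
Qed.

Lemma is_derive_sum_fun (R : realType) (V : normedModType R) n (f : 'I_n -> V -> R)
    (df : 'I_n -> R) (x v : V) :
  (forall i, is_derive x v (f i) (df i)) ->
  is_derive x v (fun y => \sum_i f i y) (\sum_i df i).
Proof.
move=> d; have -> : (fun y => \sum_i f i y) = \sum_i f i.
  by apply/funext => y; rewrite fct_sumE.
exact: is_derive_sum.
Qed.

Lemma is_derive_cmul (R : realType) (V : normedModType R) (f : V -> R) (df c : R) (x v : V) :
  is_derive x v f df -> is_derive x v (fun y => c * f y) (c * df).
Proof. by move=> d; exact: (@is_deriveZ R V R f c x v df d). Qed.

Section SpacetimeLaplacianRegularity.
Variables (R : realType) (n : nat).
Notation E := (R * 'rV[R]_n)%type.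
Variables (A : set 'rV[R]_n) (G : 'rV[R]_n -> 'M[R]_n).
Hypothesis oA : open A.
Hypothesis mG : metric_on A G.
Variables (O : set E) (F : E -> R).
Hypothesis oO : open O.
Hypothesis sF : smooth_on O F.

Lemma cometric_continuous y i j : A y -> {for y, continuous (fun z => invmx (G z) i j)}.
Proof.
move=> Ay; pose D := Region oA Ay.
have e : \forall z \near y, (sr_cometric (D := D) mG i j : smooth_ring D) z = invmx (G z) i j.
  by apply: (open_near_eq oA Ay) => z Az; rewrite sr_cometric_at.
apply: (continuous_near_eq e).
exact: (smooth_on_continuous (sr_smooth (sr_cometric (D := D) mG i j)) Ay).
Qed.

Lemma christoffel_continuous y k i j : A y -> {for y, continuous (christoffel G k i j)}.
Proof.
move=> Ay; pose D := Region oA Ay.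
pose Gam : smooth_ring D := ag_christoffel (@sr_d _ _ D) (sr_metric (D := D) mG)
  (sr_cometric (D := D) mG) (sr_const D 2^-1) k i j.
have e : \forall z \near y, Gam z = christoffel G k i j z.
  by apply: (open_near_eq oA Ay) => z Az; rewrite (christoffelE (D := D) mG).
apply: (continuous_near_eq e).
exact: (smooth_on_continuous (sr_smooth Gam) Ay).
Qed.

Lemma slice_laplacian_continuous p : O p -> A p.2 -> {for p, continuous (slice_laplacian G F)}.
Proof.
move=> Op Ap.
have c2 (f : 'rV[R]_n -> R) : {for p.2, continuous f} ->
    {for p, continuous (fun q : E => f q.2)}.
  move=> cf; apply: (@continuous_comp _ _ _ (@snd R 'rV[R]_n) f p _ cf); exact: cvg_snd.
apply: continuous_sum_at => k; apply: continuous_sum_at => l.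
refine (@continuousM R E (fun q => invmx (G q.2) k l) _ p
  (c2 _ (@cometric_continuous p.2 k l Ap)) _).
have cD v : {for p, continuous ('D_v F)}.
  exact: (smooth_on_continuous (smooth_on_derive v sF) Op).
have cDD v w : {for p, continuous ('D_v ('D_w F))}.
  exact: (smooth_on_continuous (smooth_on_derive v (smooth_on_derive w sF)) Op).
have cS : {for p, continuous (fun q : E =>
    \sum_i christoffel G i k l q.2 * 'D_(dir R i) F q)}.
  apply: continuous_sum_at => q.
  exact: (@continuousM R E (fun z => christoffel G q k l z.2) _ p
    (c2 _ (@christoffel_continuous p.2 q k l Ap)) (cD _)).
exact: (@continuousB R R E ('D_(dir R k) ('D_(dir R l) F)) _ p (cDD _ _) cS).
Qed.

(** The coefficients do not depend on time, and the time derivative commutes with the space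
    derivatives of [F] by Schwarz's theorem. *)
Lemma is_derive_slice_laplacian (s : R) y : O (s, y) ->
  is_derive s 1 (fun s => slice_laplacian G F (s, y)) (slice_laplacian G ('D_((1, 0) : E) F) (s, y)).
Proof.
move=> Osy.
have ts (H : E -> R) : smooth_on O H ->
    is_derive s 1 (fun s => H (s, y)) ('D_((1, 0) : E) H (s, y)).
  by move=> sH; apply: is_derive_time_slice; exact: smooth_on_derivable sH Osy.
have d1 q : is_derive s 1 (fun s => 'D_(dir R q) F (s, y))
    ('D_(dir R q) ('D_((1, 0) : E) F) (s, y)).
  rewrite (@smooth_on_derive_comm R _ O F (s, y) (1, 0) (dir R q) oO sF Osy).
  exact: (ts _ (smooth_on_derive (dir R q) sF)).
have d2 k l : is_derive s 1 (fun s => 'D_(dir R k) ('D_(dir R l) F) (s, y))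
    ('D_(dir R k) ('D_(dir R l) ('D_((1, 0) : E) F)) (s, y)).
  have -> : 'D_(dir R k) ('D_(dir R l) ('D_((1, 0) : E) F)) (s, y) =
     'D_((1, 0) : E) ('D_(dir R k) ('D_(dir R l) F)) (s, y).
    refine (etrans _ (@smooth_on_derive_comm R _ O ('D_(dir R l) F) (s, y) (1, 0)
      (dir R k) oO (smooth_on_derive (dir R l) sF) Osy)).
    apply: near_eq_derive; apply: (open_near_eq oO Osy) => p Op.
    exact: (@smooth_on_derive_comm R _ O F p (1, 0) (dir R l) oO sF Op).
  exact: (ts _ (smooth_on_derive (dir R k) (smooth_on_derive (dir R l) sF))).
apply: is_derive_sum_fun => k; apply: is_derive_sum_fun => l.
rewrite /=.
have dS : is_derive s 1 (fun s => \sum_q christoffel G q k l y * 'D_(dir R q) F (s, y))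
    (\sum_q christoffel G q k l y * 'D_(dir R q) ('D_((1, 0) : E) F) (s, y)).
  exact (is_derive_sum_fun (fun q => is_derive_cmul (christoffel G q k l y) (d1 q))).
exact (is_derive_cmul (invmx (G y) k l) (is_deriveB (d2 k l) dS)).
Qed.

End SpacetimeLaplacianRegularity.

(** * The differential inequality at a minimum of the Laplacian *)

Section LocalMinimum.
Variables (R : realType).

(** Unlike in [MVT_line], the intermediate parameter is strictly positive, so that its sign can be
    used in products. *)
Lemma MVT_line_pos (V : normedModType R) (f : V -> R) (z v : V) (t : R) : 0 < t ->
  (forall s, 0 <= s <= t -> derivable f (s *: v + z) v) ->
  exists2 s, 0 < s < t & f (t *: v + z) - f z = t * 'D_v f (s *: v + z).
Proof.
move=> t0 df; pose p s := f (s *: v + z).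
have dp (s : R) : 0 <= s <= t -> is_derive s 1 p ('D_v f (s *: v + z)).
  by move=> /df; exact: is_derive_line.
have [s|s|s sI E] := @MVT _ p (fun s => 'D_v f (s *: v + z)) 0 t t0.
- by rewrite in_itv /= => /andP[s0 st]; apply: dp; rewrite !ltW.
- apply: continuous_in_subspaceT => {}s /set_mem /=; rewrite in_itv /= => sI.
  have /derivable1_diffP : derivable p s 1 by apply: (@ex_derive _ _ _ _ _ _ _ (dp s sI)).
  exact: differentiable_continuous.
exists s; first by move: sI; rewrite in_itv.
have p0 : p 0 = f z by rewrite /p scale0r add0r.
by rewrite -p0 -/(p t) E subr0 mulrC.
Qed.

Lemma near_line (V : normedModType R) (y v : V) (P : V -> Prop) :
  (\forall z \near y, P z) -> exists2 d : R, 0 < d & forall s, `|s| < d -> P (s *: v + y).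
Proof.
move=> Py; have c : (fun s : R => s *: v + y) @ (0 : R) --> y.
  have : {for 0, continuous (fun s : R => s *: v + y)}.
    apply/differentiable_continuous; exact: ex_diff.
  by rewrite /prop_for /continuous_at scale0r add0r.
have /nbhs_ballP[d /= d0 ball_d] := c _ Py.
by exists d => // s sd; apply: ball_d; rewrite -ball_normE /= sub0r normrN.
Qed.

Variables (V : normedModType R) (A : set V) (f : V -> R) (y : V).
Hypothesis oA : open A.
Hypothesis sf : smooth_on A f.
Hypothesis Ay : A y.
Hypothesis y_min : forall z, A z -> f y <= f z.

Lemma derive_at_min v : 'D_v f y = 0.
Proof.
have [d d0 Ad] := near_line v (open_nbhs_nbhs (conj oA Ay)).
have zE : 0 *: v + y = y by rewrite scale0r add0r.
have inA (s : R) : s \in `]-d, d[%R -> A (s *: v + y).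
  by rewrite in_itv /= -ltr_norml => sd; exact: Ad.
have z0 : (0 : R) \in `]-d, d[%R by rewrite in_itv /= d0 oppr_lt0 d0.
have dp (s : R) : s \in `]-d, d[%R ->
    is_derive s 1 (fun s => f (s *: v + y)) ('D_v f (s *: v + y)).
  by move=> /inA As; apply: is_derive_line; exact: smooth_on_derivable sf As.
have := @derive1_at_min R (fun s => f (s *: v + y)) (- d) d 0.
case=> //.
- by lra.
- by move=> s sI; exact: (@ex_derive _ _ _ _ _ _ _ (dp s sI)).
- by move=> s sI; rewrite zE; apply: y_min; exact: inA.
move=> _; rewrite (@derive_val _ _ _ _ _ _ _ (dp 0 z0)) zE.
by [].
Qed.

(** If the second derivative were negative it would be so near [y]; two mean value steps, the first
    derivative vanishing at [y], would then yield a smaller value of [f]. *)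
Lemma derive2_at_min v : 0 <= 'D_v ('D_v f) y.
Proof.
rewrite leNgt; apply/negP => neg.
have sf1 := smooth_on_derive v sf.
have c2 : {for y, continuous ('D_v ('D_v f))}.
  exact: (smooth_on_continuous (smooth_on_derive v sf1) Ay).
have n2 : \forall z \near y, 'D_v ('D_v f) z < 0.
  exact: (cvgr_lt _ c2 _ neg).
have [d d0 near_d] := near_line v (filterI (open_nbhs_nbhs (conj oA Ay)) n2).
have t0 : 0 < d / 2 by rewrite divr_gt0.
have small s : 0 <= s <= d / 2 -> `|s| < d.
  by move=> /andP[s0 sd]; rewrite ger0_norm //; lra.
have [|s sI E] := @MVT_line_pos V f y v (d / 2) t0.
  by move=> s /small /near_d[As _]; exact: smooth_on_derivable sf As.
have [s0 st] : 0 < s /\ s < d / 2 by move: sI => /andP[].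
have small' r : 0 <= r <= s -> `|r| < d.
  by move=> /andP[r0 rs]; apply: small; lra.
have [|r rI E'] := @MVT_line_pos V ('D_v f) y v s s0.
  by move=> r /small' /near_d[Ar _]; exact: smooth_on_derivable sf1 Ar.
have [|_ neg2] := near_d r.
  by apply: small'; move: rI => /andP[? ?]; rewrite !ltW.
rewrite (derive_at_min v) subr0 in E'.
have : f ((d / 2) *: v + y) - f y < 0.
  by rewrite E E' pmulr_rlt0 // pmulr_rlt0.
have [|Ad _] := near_d (d / 2); first by apply: small; rewrite lexx ltW.
by rewrite subr_lt0 ltNge y_min.
Qed.

End LocalMinimum.

Section LaplacianAtMinimum.
Variables (R : realType) (n : nat) (D : region R n) (G : 'rV[R]_n -> 'M[R]_n).
Notation A := (reg_set D).
Notation T := (smooth_ring D).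
Hypothesis mG : metric_on A G.
Notation h := (sr_cometric mG).
Notation lap := (ag_lap (@sr_d R n D) (sr_metric mG) h (sr_const D 2^-1)).

Lemma derive_partials (f : 'rV[R]_n -> R) v y : smooth_on A f -> A y ->
  'D_v f y = \sum_i v 0 i * 'D_(delta_mx 0 i) f y.
Proof.
move=> sf Ay.
have [fd fD] : differentiable f y /\
    forall v, 'd f y v = \sum_i v 0 i * 'D_(delta_mx 0 i) f y.
  apply: differentiable_of_partials.
    apply: filterS (open_nbhs_nbhs (conj (reg_open D) Ay)) => z Bz j.
    exact: smooth_on_derivable sf Bz.
  by move=> j; exact: (smooth_on_continuous (smooth_on_derive _ sf) Ay).
by rewrite deriveE.
Qed.

Lemma invmx_pos y (v : 'rV[R]_n) : A y -> v != 0 -> 0 < (v *m invmx (G y) *m v^T) 0 0.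
Proof.
move=> Ay; apply: (posdef_inv (g := G y)).
- by rewrite mulVmx //; apply: posdef_unit => w; exact: mo_pos mG y w Ay.
- exact: mo_sym mG y Ay.
- by move=> w; exact: mo_pos mG y w Ay.
Qed.

Lemma invmx_sym y : A y -> (invmx (G y))^T = invmx (G y).
Proof. by move=> Ay; rewrite trmx_inv (mo_sym mG). Qed.

(** The Christoffel terms carry first derivatives, which vanish at the minimum. What is left is the
    trace of the inverse metric times a matrix [B] whose quadratic form is a second directional
    derivative. *)
Lemma laplacian_at_min (f : T) y : A y -> (forall z, A z -> f y <= f z) ->
  (forall i, sr_d i f y = 0) /\ 0 <= (lap f : T) y.
Proof.
move=> Ay fmin; have sf := sr_smooth f.
have D0 v : 'D_v f y = 0 by exact: (derive_at_min (reg_open D) sf Ay fmin).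
have d0 i : sr_d i f y = 0 by rewrite sr_mkE.
split => //; pose B := \matrix_(k, l) 'D_(delta_mx 0 k) ('D_(delta_mx 0 l) f) y.
have -> : (lap f : T) y = \tr (invmx (G y) *m B).
  rewrite (ag_lapE (sr_metricData mG)) -[LHS](sr_evE Ay) rmorph_sum.
  apply: eq_bigr => k _; rewrite mxE rmorph_sum; apply: eq_bigr => l _.
  rewrite rmorphM rmorphB rmorph_sum /= !sr_evE (sr_cometric_at mG Ay) big1.
    rewrite subr0 mxE; congr (_ * _).
    rewrite -[LHS]/(sr_der _ (sr_der _ f) y) sr_derC.
    by apply: sr_derE => // z Az; exact: sr_mkE.
  by move=> q _; rewrite rmorphM /= !sr_evE d0 mulr0.
rewrite -oppr_le0 -linearN /= -mulmxN; apply: mxtrace_mul_le0.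
- exact: invmx_sym.
- by move=> v; exact: invmx_pos.
move=> v; rewrite mulmxN mulNmx mxE oppr_le0.
suff -> : (v *m B *m v^T) 0 0 = 'D_v ('D_v f) y.
  exact: (derive2_at_min (reg_open D) sf Ay fmin).
rewrite (derive_partials _ (smooth_on_derive v sf) Ay) mxE.
apply: eq_bigr => i _; rewrite [v^T _ _]mxE mulrC; congr (_ * _).
have -> : 'D_(delta_mx 0 i) ('D_v f) y = 'D_v ('D_(delta_mx 0 i) f) y.
  exact: (smooth_on_derive_comm _ _ (reg_open D) sf Ay).
rewrite (derive_partials _ (smooth_on_derive _ sf) Ay) mxE.
by apply: eq_bigr => j _; rewrite mxE.
Qed.

End LaplacianAtMinimum.

Section LocalEvolution.
Variables (R : realType) (n : nat) (D : region R n) (G : 'rV[R]_n -> 'M[R]_n).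
Notation A := (reg_set D).
Notation T := (smooth_ring D).
Notation E := (R * 'rV[R]_n)%type.
Hypothesis mG : metric_on A G.
Variables (m : R) (O : set E) (F : E -> R).
Hypothesis m_neq1 : m != 1.
Hypothesis m_gt0 : 0 < m.
Hypothesis oO : open O.
Hypothesis sF : smooth_on O F.
Hypothesis F_gt0 : forall p, O p -> 0 < F p.

Definition pressure (p : E) : R := m / (m - 1) * F p `^ (m - 1).

Lemma pressure_smooth : smooth_on O pressure.
Proof.
apply: (smooth_genP oO); apply: sg_mul.
  exact: (sg_smooth (smooth_on_cst (m / (m - 1)) oO)).
exact: sg_powR (sg_smooth sF) F_gt0.
Qed.

Lemma derive_pressure p v : O p ->
  'D_v pressure p = m * F p `^ (m - 1) / F p * 'D_v F p.
Proof.
move=> Op; have F0 := F_gt0 Op; have Fn0 : F p != 0 by rewrite gt_eqF.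
have m1 : m - 1 != 0 by rewrite subr_eq0.
have d := is_derive_cmul (m / (m - 1))
  (is_derive_powR_comp (m - 1) (smooth_on_derivable sF Op : derivable F p v) F0).
rewrite -[pressure]/(fun p => m / (m - 1) * F p `^ (m - 1)).
rewrite (@derive_val _ _ _ _ _ _ _ d).
have -> : F p `^ (m - 1 - 1) = F p `^ (m - 1) / F p.
  by rewrite powRB ?Fn0 ?implybT // powRr1 // ltW.
by field; rewrite Fn0.
Qed.

Variables (t0 k3 : R) (U : 'rV[R]_n -> R) (y0 : 'rV[R]_n).
Hypothesis n_gt0 : (0 < n)%N.
Hypothesis ricci_ge0 : forall y (v : 'rV[R]_n), A y -> 0 <= (v *m ricci G y *m v^T) 0 0.
Hypothesis sU : smooth_on A U.
Hypothesis AO : forall y, A y -> O (t0, y).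
Hypothesis F_eq : forall y, A y -> 'D_((1, 0) : E) F (t0, y) =
  local_laplacian G (fun z => F (t0, z) `^ m) y + U y * F (t0, y) `^ (2 - m).
Hypothesis Ay0 : A y0.
Hypothesis U_lap : k3 / (2 * m) <= local_laplacian G U y0.
Hypothesis y0_min : forall y, A y ->
  slice_laplacian G pressure (t0, y0) <= slice_laplacian G pressure (t0, y).

Notation h := (sr_cometric mG).
Notation d := (@sr_d R n D).
Notation lap := (ag_lap d (sr_metric mG) h (sr_const D 2^-1)).
Notation cov := (ag_cov d (sr_metric mG) h (sr_const D 2^-1)).
Notation hess := (ag_hess d (sr_metric mG) h (sr_const D 2^-1)).

Lemma pressure_evolution :
  (m - 1 + 2 / n%:R) * slice_laplacian G pressure (t0, y0) ^+ 2 + k3 / 2 <=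
  slice_laplacian G ('D_((1, 0) : E) pressure) (t0, y0).
Proof.
have oA := reg_open D.
have sslice (H : E -> R) : smooth_on O H -> smooth_on A (fun y => H (t0, y)).
  by move=> sH; exact: (smooth_on_space_slice oA sH AO).
have sDt (H : E -> R) : smooth_on O H -> smooth_on O ('D_((1, 0) : E) H).
  exact: smooth_on_derive.
pose r : T := sr_mk (sg_smooth (sslice _ sF)).
pose rt : T := sr_mk (sg_smooth (sslice _ (sDt _ sF))).
pose v : T := sr_mk (sg_smooth (sslice _ pressure_smooth)).
pose vt : T := sr_mk (sg_smooth (sslice _ (sDt _ pressure_smooth))).
pose Us : T := sr_mk (sg_smooth sU).
have rE y : A y -> r y = F (t0, y) by move=> Ay; rewrite sr_mkE.
have r_gt0 y : A y -> 0 < r y by move=> Ay; rewrite rE //; exact: F_gt0 (AO Ay).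
have r_neq0 y : A y -> r y != 0 by move=> Ay; rewrite gt_eqF // r_gt0.
pose ri : T := sr_mk (sg_inv (sr_gen r) r_neq0).
pose p : T := sr_mk (sg_powR (m - 1) (sr_gen r) r_gt0).
have p_neq0 y : A y -> p y != 0.
  by move=> Ay; rewrite sr_mkE // gt_eqF // powR_gt0 // r_gt0.
pose q : T := sr_mk (sg_inv (sr_gen p) p_neq0).
pose mc := sr_const D m.
have vE y : A y -> v y = pressure (t0, y) by move=> Ay; rewrite sr_mkE.
have vtE y : A y -> vt y = 'D_((1, 0) : E) pressure (t0, y) by move=> Ay; rewrite sr_mkE.
have riE y : A y -> ri y = (F (t0, y))^-1 by move=> Ay; rewrite sr_mkE // rE.
have pE y : A y -> p y = F (t0, y) `^ (m - 1) by move=> Ay; rewrite sr_mkE // rE.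
have qE y : A y -> q y = (F (t0, y) `^ (m - 1))^-1 by move=> Ay; rewrite sr_mkE // pE.
have mcE y : A y -> mc y = m by move=> Ay; rewrite sr_mkE.
have rtE y : A y -> rt y = 'D_((1, 0) : E) F (t0, y) by move=> Ay; rewrite sr_mkE.
have UE y : A y -> Us y = U y by move=> Ay; rewrite sr_mkE.
have md := sr_metricData mG.
have m1 : m - 1 != 0 by rewrite subr_eq0.
have Fn0 y : A y -> F (t0, y) != 0 by move=> Ay; rewrite -rE // r_neq0.
have dr i y : A y -> d i r y = 'D_(dir R i) F (t0, y).
  move=> Ay; have e := is_derive_space_slice (smooth_on_derivable sF (AO Ay)
    : derivable F (t0, y) (0, delta_mx 0 i)).
  have -> : d i r y = 'D_(delta_mx 0 i) (fun y => F (t0, y)) y by exact: sr_derE rE Ay.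
  exact: (@derive_val _ _ _ _ _ _ _ e).
have dv0 i y : A y -> d i v y = 'D_(dir R i) pressure (t0, y).
  move=> Ay; have e := is_derive_space_slice (smooth_on_derivable pressure_smooth (AO Ay)
    : derivable pressure (t0, y) (0, delta_mx 0 i)).
  have -> : d i v y = 'D_(delta_mx 0 i) (fun y => pressure (t0, y)) y by exact: sr_derE vE Ay.
  exact: (@derive_val _ _ _ _ _ _ _ e).
have dm i : d i mc = 0 by exact: sr_der_const.
have rK : r * ri = 1.
  apply: sr_eq => y Ay; rewrite -!(sr_evE Ay) rmorphM rmorph1 /= !sr_evE rE // riE //.
  by rewrite mulfV // Fn0.
have pK : p * q = 1.
  apply: sr_eq => y Ay; rewrite -!(sr_evE Ay) rmorphM rmorph1 /= !sr_evE pE // qE //.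
  by rewrite mulfV // -pE // p_neq0.
have dv i : d i v = mc * p * ri * d i r.
  apply: sr_eq => y Ay; rewrite dv0 // derive_pressure; last exact: AO.
  by rewrite -[RHS](sr_evE Ay) !rmorphM /= !sr_evE mcE // pE // riE // dr.
have mv : (mc - 1) * v = mc * p.
  apply: sr_eq => y Ay; rewrite -[LHS](sr_evE Ay) -[RHS](sr_evE Ay).
  rewrite !rmorphM rmorphB rmorph1 /= !sr_evE mcE // pE // vE // /pressure.
  by field.
have dm1 i : d i (mc - 1) = 0.
  rewrite (ag_dB md) dm sub0r; apply/eqP; rewrite oppr_eq0; apply/eqP.
  exact: sr_der_const.
have dp i : d i p = (mc - 1) * p * ri * d i r.
  (* Differentiating (m - 1) v = m p gives (m - 1) dv = m dp, from which the nonzero constant m is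
     cancelled. *)
  have := congr1 (d i) mv; rewrite !(md_M md) dm dm1 !mul0r !add0r dv => e.
  apply: sr_eq => y Ay.
  have := congr1 (fun f : T => f y) e.
  rewrite -!(sr_evE Ay) !rmorphM rmorphB rmorph1 /= !sr_evE mcE // => e'.
  apply: (mulfI (lt0r_neq0 m_gt0)); rewrite -e'; ring.
have vtr : vt = mc * p * ri * rt.
  apply: sr_eq => y Ay; rewrite vtE // derive_pressure; last exact: AO.
  by rewrite -[RHS](sr_evE Ay) !rmorphM /= !sr_evE mcE // pE // riE // rtE.
have rt_eq : rt = lap (p * r) + Us * (r * q).
  apply: sr_eq => y Ay; rewrite rtE // F_eq //.
  rewrite -[RHS](sr_evE Ay) rmorphD !rmorphM /= !sr_evE UE // rE // qE //.
  have F0 : 0 < F (t0, y) by apply: F_gt0; exact: AO.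
  congr (_ + _ * _).
    apply: local_laplacianE => // z Az.
    have F0z : 0 < F (t0, z) by apply: F_gt0; exact: AO.
    rewrite -[RHS](sr_evE Az) rmorphM /= !sr_evE pE // rE //.
    by rewrite -[X in _ * X]powRr1 ?ltW // -powRD ?subrK // gt_eqF // implybT.
  rewrite -[X in X / _]powRr1 ?ltW // -powRB; last by rewrite Fn0 // implybT.
  by congr (_ `^ _); ring.
have main := ag_pressure_lap md dm rK pK dp dv mv vtr rt_eq.
have lapE (H : E -> R) (sH : smooth_on O H) (f : T) y :
    (forall z, A z -> f z = H (t0, z)) -> A y -> (lap f : T) y = slice_laplacian G H (t0, y).
  move=> fH Ay; rewrite -(slice_laplacianE oA mG oO sH (AO Ay) Ay).
  by apply/esym/local_laplacianE => // z Az; rewrite fH.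
have LvE y (Ay : A y) := lapE _ pressure_smooth v y vE Ay.
have Lmin y : A y -> (lap v : T) y0 <= (lap v : T) y.
  by move=> Ay; rewrite (LvE _ Ay0) (LvE _ Ay); exact: y0_min.
have [dL0 lapL0] := laplacian_at_min mG Ay0 Lmin.
have LE : (lap v : T) y0 = slice_laplacian G pressure (t0, y0).
  exact: (lapE _ pressure_smooth v y0 vE Ay0).
have LtE : (lap vt : T) y0 = slice_laplacian G ('D_((1, 0) : E) pressure) (t0, y0).
  exact: (lapE _ (sDt _ pressure_smooth) vt y0 vtE Ay0).
have form0 a : (ag_form d h a (lap v) : T) y0 = 0.
  rewrite -(sr_evE Ay0) rmorph_sum big1 // => i _.
  by rewrite rmorphM /= !sr_evE dL0 mulr0.
(* The endomorphism nabla grad v at [y0]: its trace is Lap v and the trace of its square is |Hess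
   v|^2. *)
pose M : 'M[R]_n := invmx (G y0) *m (\matrix_(k, l) (hess v k l : T) y0).
have covE k i : (cov (ag_grad d h v) k i : T) y0 = M k i.
  rewrite (ag_cov_grad md) -(sr_evE Ay0) rmorph_sum mxE; apply: eq_bigr => l _.
  by rewrite rmorphM /= !sr_evE (sr_cometric_at mG Ay0) mxE (ag_hessC md).
have trM : \tr M = slice_laplacian G pressure (t0, y0).
  rewrite -LE -[RHS](sr_evE Ay0) rmorph_sum; apply: eq_bigr => k _.
  by rewrite /= sr_evE covE.
have trMM : \tr (M *m M) =
    (\sum_k \sum_i cov (ag_grad d h v) k i * cov (ag_grad d h v) i k : T) y0.
  rewrite -[RHS](sr_evE Ay0) rmorph_sum; apply: eq_bigr => k _.
  rewrite mxE rmorph_sum; apply: eq_bigr => i _.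
  by rewrite rmorphM /= !sr_evE !covE.
have trace_ineq : (\tr M) ^+ 2 <= n%:R * \tr (M *m M).
  apply: sqr_mxtrace_le.
  - exact: (invmx_sym (D := D) mG Ay0).
  - by move=> w; exact: (invmx_pos (D := D) mG Ay0).
  - by apply/matrixP => k l; rewrite !mxE (ag_hessC md).
have ric : 0 <= (\sum_i \sum_k ag_grad d h v i * ag_grad d h v k *
    ag_ricci d (sr_metric mG) h (sr_const D 2^-1) i k : T) y0.
  apply: le_trans (ricci_ge0 (\row_i (ag_grad d h v i : T) y0) Ay0) _.
  rewrite le_eqVlt; apply/orP; left; apply/eqP.
  rewrite exchange_big /= mxE -[RHS](sr_evE Ay0) rmorph_sum; apply: eq_bigr => k _.
  rewrite mxE rmorph_sum mulr_suml; apply: eq_bigr => i _.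
  by rewrite !rmorphM /= !sr_evE (ricciE mG) // !mxE; ring.
have lapU : k3 / (2 * m) <= (lap Us : T) y0.
  by rewrite -(local_laplacianE mG (fun z Az => esym (UE z Az)) Ay0).
have p_gt0 : 0 < p y0 by rewrite pE // powR_gt0 // -rE // r_gt0.
have evalE (a1 a2 f1 S1 f2 S2 a3 : T) :
    (mc * p * a1 + (mc - 1) * a2 * a2 + 2 * f1 + 2 * (S1 + f2 + S2) + mc * a3 : T) y0 =
    m * p y0 * a1 y0 + (m - 1) * a2 y0 * a2 y0 + 2 * f1 y0 +
    2 * (S1 y0 + f2 y0 + S2 y0) + m * a3 y0.
  rewrite -[LHS](sr_evE Ay0) !rmorphD !rmorphM !rmorphD rmorphN rmorph1 /=.
  by rewrite !sr_evE mcE.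
rewrite -LtE main evalE !form0 -trMM LE -trM in trace_ineq *.
have n0 : 0 < n%:R :> R by rewrite ltr0n.
have mU : k3 / 2 <= m * (lap Us : T) y0.
  move: lapU; rewrite -(ler_pM2l m_gt0); apply: le_trans.
  by rewrite le_eqVlt; apply/orP; left; apply/eqP; field; rewrite gt_eqF.
have mp : 0 <= m * p y0 * (lap (lap v) : T) y0 by rewrite !mulr_ge0 // ltW.
(* The Bochner term supplies the part 2/n of beta; the part m - 1 is already the coefficient of (Lap
   v)^2. *)
have tr2 : 2 / n%:R * (\tr M) ^+ 2 <= 2 * \tr (M *m M).
  by rewrite -mulrA ler_pM2l // ler_pdivrMl.
move: mU mp tr2 ric.
set a := m * (lap Us : T) y0; set b := m * p y0 * _; set c := \tr (M *m M).
set S2 := sr_val _ _; set t := \tr M => mU mp tr2 ric.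
have -> : (m - 1) * t * t = (m - 1) * t ^+ 2 by ring.
move: mU mp tr2 ric; rewrite (mulrDl (m - 1)); clearbody a b c S2.
move: (2 / n%:R * _) ((m - 1) * _) => w u; lra.
Qed.

End LocalEvolution.

(** * From charts to the manifold *)

Lemma open_preimage_on (T S : topologicalType) (A : set T) (B : set S) (f : T -> S) :
  open A -> open B -> (forall x, A x -> {for x, continuous f}) ->
  open [set x | A x /\ B (f x)].
Proof.
move=> oA oB cf; rewrite openE => x [Ax Bx].
apply: (filterI (open_nbhs_nbhs (conj oA Ax))).
exact: (cf x Ax _ (open_nbhs_nbhs (conj oB Bx))).
Qed.

Lemma metric_on_subset (R : realType) n (A B : set 'rV[R]_n) G :
  B `<=` A -> metric_on A G -> metric_on B G.
Proof.
move=> BA mG; split.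
- exact: (smooth_on_subset BA (mo_smooth mG)).
- by move=> y /BA; exact: mo_sym mG y.
- by move=> y v /BA; exact: mo_pos mG y v.
Qed.

Lemma eq_local_laplacian (R : realType) n (A : set 'rV[R]_n) G (u w : 'rV[R]_n -> R) y :
  open A -> metric_on A G -> smooth_on A w -> (forall z, A z -> u z = w z) -> A y ->
  local_laplacian G u y = local_laplacian G w y.
Proof.
move=> oA mG sw uw Ay; pose D := Region oA Ay.
pose f : smooth_ring D := sr_mk (sg_smooth (sw : smooth_on (reg_set D) w)).
have wf z : A z -> w z = f z by move=> Az; rewrite sr_mkE.
rewrite (@local_laplacianE _ _ D _ mG w f y wf Ay).
by rewrite (@local_laplacianE _ _ D _ mG u f y _ Ay) // => z Az; rewrite uw // wf.
Qed.

Lemma local_laplacian_scale (R : realType) n (A : set 'rV[R]_n) G (u : 'rV[R]_n -> R) c y :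
  open A -> metric_on A G -> smooth_on A u -> A y ->
  local_laplacian G (fun z => c * u z) y = c * local_laplacian G u y.
Proof.
move=> oA mG su Ay; pose D := Region oA Ay.
pose f : smooth_ring D := sr_mk (sg_smooth (su : smooth_on (reg_set D) u)).
have uf z : A z -> u z = f z by move=> Az; rewrite sr_mkE.
rewrite (@local_laplacianE _ _ D _ mG u f y uf Ay).
rewrite (@local_laplacianE _ _ D _ mG _ (sr_const D c * f) y _ Ay); last first.
  by move=> z Az; rewrite -[RHS](sr_evE (D := D) Az) rmorphM /= !sr_evE sr_mkE // uf.
rewrite (ag_lapZ (sr_metricData (D := D) mG)); last by move=> i; exact: sr_der_const.
by rewrite -[LHS](sr_evE (D := D) Ay) rmorphM /= !sr_evE sr_mkE.
Qed.

Section Charts.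
Variables (R : realType) (n : nat) (M : riemannianManifold R n).
Implicit Type c : chart R n M.

Lemma metric_on_chart c : atlas c -> metric_on (chart_cod c) (metric c).
Proof.
move=> ac; split; first exact: metric_smooth.
  by move=> y cy; exact: Defs.metric_sym.
by move=> y v cy v0; exact: metric_pos.
Qed.

Lemma chart_cod_map c x : chart_dom c x -> chart_cod c (chart_map c x).
Proof. by move=> dx; exists x. Qed.

Lemma chart_invK c y : chart_cod c y -> chart_dom c (chart_inv c y) /\
  chart_map c (chart_inv c y) = y.
Proof. by move=> [x dx <-]; rewrite chart_mapK. Qed.

(** Moves the computation from the chart chosen at [x] to a fixed chart. Smoothness is asked only on
    a small set [B], because the solution is known through extensions that live on such sets. *)
Lemma laplacian_chart c (f : M -> R) x (B : set 'rV[R]_n) :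
  atlas c -> chart_dom c x -> open B -> B `<=` chart_cod c -> B (chart_map c x) ->
  smooth_on B (f \o chart_inv c) ->
  laplacian f x = local_laplacian (metric c) (f \o chart_inv c) (chart_map c x).
Proof.
move=> ac dx oB BA Bx sf; rewrite /laplacian /chart_at.
case: (cid2 (atlas_cover x)) => c0 /= ac0 d0x.
pose phi := transition c0 c; set y := chart_map c0 x.
pose A1 := [set z | chart_cod c0 z /\ chart_dom c (chart_inv c0 z)].
have oA1 : open A1.
  exact (open_preimage_on (@chart_cod_open _ _ _ c0) (@chart_dom_open _ _ _ c)
    (fun z cz => chart_inv_continuous cz)).
have cphi z : A1 z -> {for z, continuous phi}.
  move=> [cz dz]; apply: (@continuous_comp _ _ _ (chart_inv c0) (chart_map c) z).
    exact: chart_inv_continuous.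
  exact: chart_map_continuous.
pose A := [set z | A1 z /\ B (phi z)].
have oA : open A := open_preimage_on oA1 oB cphi.
have Ay : A y.
  by rewrite /A /A1 /phi /transition /= /y chart_mapK //; split=> //; split=> //; exists x.
have Atr z : A z -> transition_dom c0 c z.
  by move=> [[[w dw <-] dz] _]; exists w => //; split => //; rewrite chart_mapK // in dz.
have mA : metric_on A (metric c0).
  by apply: metric_on_subset (metric_on_chart ac0) => z [[]].
have mB : metric_on B (metric c) by exact: metric_on_subset BA (metric_on_chart ac).
pose D := Region oA Ay; pose D' := Region oB Bx.
have sphi : smooth_on A phi := smooth_on_subset Atr (atlas_smooth ac0 ac).
have phiy : phi y = chart_map c x by rewrite /phi /transition /= /y chart_mapK.
have phiD z : reg_set D z -> reg_set D' (phi z) by move=> [].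
have := @local_laplacian_change R n D D' (metric c0) (metric c) phi mA mB sphi phiD
  (fun z v w Az => metric_change v w ac0 ac (Atr z Az)) (f \o chart_inv c) y sf Ay.
rewrite phiy => <-; apply: (@eq_local_laplacian _ _ A) => //.
  apply: (smooth_genP oA); apply: (sg_comp oB sf phiD) => i.
  exact: (sg_smooth (smooth_on_mx 0 i oA sphi)).
by move=> z [[cz dz] _]; rewrite /phi /transition /= chart_mapK.
Qed.

Hypothesis M_compact : compact [set: M].

(** The point [x] makes the compact space nonempty, so that [U] has a maximum; the minimum lemma is
    applied to -U. *)
Lemma laplacian_le0_somewhere (U : M -> R) (x : M) : smooth_function U ->
  exists z, laplacian U z <= 0.
Proof.
move=> sU.
have cU z : {for z, continuous U}.
  have [c ac dz] := atlas_cover z.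
  have cod_z := chart_cod_map dz.
  have e : \forall w \near z, ((U \o chart_inv c) \o chart_map c) w = U w.
    by apply: (open_near_eq (@chart_dom_open _ _ _ c) dz) => w dw /=; rewrite chart_mapK.
  apply: (continuous_near_eq e).
  apply: (@continuous_comp _ _ _ (chart_map c) (U \o chart_inv c) z).
    exact: chart_map_continuous.
  exact: (smooth_on_continuous (sU c ac) cod_z).
have [z _ zmax] : exists2 z, z \in [set: M] & forall w, w \in [set: M] -> U w <= U z.
  apply: compact_EVT_max => //; first by exists x.
  by apply: continuous_subspaceT => w; exact: cU.
exists z; have [c ac dz] := atlas_cover z.
have cod_z := chart_cod_map dz.
have oB : open (chart_cod c) := @chart_cod_open _ _ _ c.
rewrite (laplacian_chart ac dz oB (@subset_refl _ _) cod_z (sU c ac)).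
pose D := Region oB cod_z.
have mG : metric_on (reg_set D) (metric c) := metric_on_chart ac.
pose f : smooth_ring D := sr_mk (sg_smooth (sU c ac : smooth_on (reg_set D) _)).
have uf w : reg_set D w -> (U \o chart_inv c) w = f w by move=> Dw; rewrite sr_mkE.
rewrite (local_laplacianE mG uf cod_z).
pose g : smooth_ring D := sr_const D (-1) * f.
have gE w : reg_set D w -> g w = - f w.
  by move=> Dw; rewrite -[LHS](sr_evE Dw) rmorphM /= !sr_evE sr_mkE // mulN1r.
have [|_] := @laplacian_at_min _ _ D _ mG g _ cod_z.
  move=> w Dw; rewrite !gE // lerN2 -!uf //= chart_mapK //.
  by apply: zmax; rewrite inE.
rewrite (ag_lapZ (sr_metricData (D := D) mG)); last by move=> i; exact: sr_der_const.
rewrite -[leRHS](sr_evE (D := D) cod_z) rmorphM /= !sr_evE sr_mkE // mulN1r.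
by rewrite oppr_ge0.
Qed.

End Charts.

(** * The solution in a chart, up to the end points of the time interval *)

Section EvolutionInCharts.
Variables (R : realType) (n : nat) (M : riemannianManifold R n).
Variables (m : R) (J : set R) (rho : R -> M -> R).
Notation E := (R * 'rV[R]_n)%type.
Hypothesis rho_smooth : smooth_evolution J rho.
Hypothesis rho_pos : forall t x, J t -> 0 < rho t x.

(** [F] is smooth on an open set that may contain times outside [J], so it has two-sided time
    derivatives even at an end point of [J]; it agrees with the solution only at times in [J]. *)
Record chart_extension (c : chart R n M) (O : set E) (F : E -> R) : Prop :=
  ChartExtension {
  ce_open : open O;
  ce_smooth : smooth_on O F;
  ce_pos : forall p, O p -> 0 < F p;
  ce_cod : forall p, O p -> chart_cod c p.2;
  ce_rho : forall p, O p -> J p.1 -> rho p.1 (chart_inv c p.2) = F p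
}.

Lemma chart_extension_exists c t x : atlas c -> chart_dom c x -> J t ->
  exists O F, chart_extension c O F /\ O (t, chart_map c x).
Proof.
move=> ac dx Jt; have cx := chart_cod_map dx.
have [Q [F [oQ Qp sF FE]]] := rho_smooth ac (conj Jt cx : (J `*` chart_cod c) (t, chart_map c x)).
(* The domain is shrunk to where the extension is positive, which makes its real powers smooth. *)
pose O1 := [set p | Q p /\ [set r : R | 0 < r] (F p)].
have oO1 : open O1.
  exact (open_preimage_on oQ (@open_gt R 0) (fun p Qp => smooth_on_continuous sF Qp)).
pose O2 := [set p : E | O1 p /\ chart_cod c p.2].
have oO2 : open O2.
  refine (open_preimage_on (f := snd) oO1 (@chart_cod_open _ _ _ c) _).
  by move=> p _; exact: cvg_snd.
exists O2, F; split; last first.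
  split=> //; split=> //=; rewrite (FE _ Qp) //= chart_mapK //; exact: rho_pos.
split=> //.
- apply: (@smooth_on_subset _ _ _ Q O2 F _ sF); by move=> p [[]].
- by move=> p [[]].
- by move=> p [].
- by move=> p [[Op' _] cp] Jp; rewrite FE.
Qed.

Variables (c : chart R n M) (O : set E) (F : E -> R).
Hypothesis ac : atlas c.
Hypothesis ce : chart_extension c O F.

Let oB t : open [set y | O (t, y)] := open_space_slice t (ce_open ce).
Let BA t : [set y | O (t, y)] `<=` chart_cod c. Proof. by move=> y /(ce_cod ce). Qed.
Let mB t : metric_on [set y | O (t, y)] (metric c) :=
  metric_on_subset (@BA t) (metric_on_chart ac).

Lemma smooth_powR_slice t a : smooth_on [set y | O (t, y)] (fun y => F (t, y) `^ a).
Proof.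
have sFt : smooth_on [set y | O (t, y)] (fun y => F (t, y)).
  exact (smooth_on_space_slice (@oB t) (ce_smooth ce) (fun y Oy => Oy)).
refine (smooth_genP (@oB t) (sg_powR a (sg_smooth sFt) _)).
by move=> y; exact: ce_pos ce (t, y).
Qed.

Lemma laplacian_powR t x a : J t -> chart_dom c x -> O (t, chart_map c x) ->
  laplacian (fun z => rho t z `^ a) x =
  local_laplacian (metric c) (fun z => F (t, z) `^ a) (chart_map c x).
Proof.
move=> Jt dx Ox.
have uF z : O (t, z) -> ((fun z => rho t z `^ a) \o chart_inv c) z = F (t, z) `^ a.
  by move=> Oz /=; rewrite (ce_rho ce Oz Jt).
have sf : smooth_on [set y | O (t, y)] ((fun z => rho t z `^ a) \o chart_inv c).
  exact (smooth_on_eq (@oB t) (fun z Oz => esym (uF z Oz)) (@smooth_powR_slice t a)).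
rewrite (laplacian_chart ac dx (@oB t) (@BA t) Ox sf).
exact: (eq_local_laplacian (@oB t) (@mB t) (@smooth_powR_slice t a) uF Ox).
Qed.

Lemma laplacian_pressure t x : J t -> chart_dom c x -> O (t, chart_map c x) ->
  m / (m - 1) * laplacian (fun z => rho t z `^ (m - 1)) x =
  slice_laplacian (metric c) (pressure m F) (t, chart_map c x).
Proof.
move=> Jt dx Ox; rewrite laplacian_powR //.
have sP := pressure_smooth m (ce_open ce) (ce_smooth ce) (ce_pos ce).
have cx := chart_cod_map dx.
rewrite -(slice_laplacianE (@chart_cod_open _ _ _ c) (metric_on_chart ac) (ce_open ce) sP Ox cx).
by rewrite -(local_laplacian_scale _ (@oB t) (@mB t) (@smooth_powR_slice t _) Ox).
Qed.

Lemma derive_time_extension (t : R) x (L : R) : is_interval J -> J 0 -> 0 < t ->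
  J t -> O (t, chart_map c x) -> chart_dom c x ->
  (s - t)^-1 * (rho s x - rho t x) @[s --> within J t^'] --> L ->
  'D_((1, 0) : E) F (t, chart_map c x) = L.
Proof.
move=> Jint J0 t0 Jt Ox dx Llim.
set y := chart_map c x in Ox *.
(* All of [0, t] lies in [J], so [t] is a limit of times of [J] from the left even if it is the last
   one. The one-sided quotient then has a unique limit, which is the full time derivative of [F]. *)
have PF : ProperFilter (within J t^').
  apply: Build_ProperFilter_ex => P.
  rewrite /within /= => /nbhs_ballP[r /= r0 ballP].
  pose s := Num.max (t - r / 2) 0.
  have s0 : 0 <= s by rewrite le_max lexx orbT.
  have st : s < t by rewrite gt_max t0 andbT; lra.
  exists s; apply: ballP; last by apply: (Jint 0 t) => //; rewrite s0 ltW.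
    rewrite /ball /= ger0_norm ?subr_ge0 ?ltW //.
    have : t - r / 2 <= s by rewrite le_max lexx.
    by lra.
  by rewrite lt_eqF.
have d := is_derive_time_slice (smooth_on_derivable (ce_smooth ce) Ox
  : derivable F (t, y) ((1, 0) : E)).
have dF : h^-1 *: (F (h *: 1 + t, y) - F (t, y)) @[h --> 0^'] --> 'D_((1, 0) : E) F (t, y).
  have dd := @ex_derive _ _ _ _ _ _ _ d.
  by rewrite -(@derive_val _ _ _ _ _ _ _ d).
have rhoE s : O (s, y) -> J s -> rho s x = F (s, y).
  by move=> Os Js; rewrite -(ce_rho ce Os Js) /= /y chart_mapK.
have dF2 : (s - t)^-1 * (rho s x - rho t x) @[s --> within J t^'] -->
    'D_((1, 0) : E) F (t, y).
  apply/cvgrPdist_le => e e0; move/cvgrPdist_le : dF => /(_ e e0).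
  move=> /nbhs_ballP[r1 /= r10 ball1].
  have /nbhs_ballP[r2 /= r20 ball2] : \forall s \near t, O (s, y).
    exact (@pair_l_continuous R 'rV[R]_n y t O (open_nbhs_nbhs (conj (ce_open ce) Ox))).
  apply/nbhs_ballP; exists (Num.min r1 r2) => /=; first by rewrite lt_min r10.
  move=> s; rewrite /ball /= lt_min => /andP[sr1 sr2] st Js.
  have := ball1 (s - t); rewrite /ball /= sub0r normrN distrC => /(_ sr1).
  rewrite subr_eq0 => /(_ st); rewrite [(s - t) *: 1]mulr1 subrK.
  by rewrite !rhoE //; exact: ball2.
exact: (cvg_unique _ dF2 Llim).
Qed.

End EvolutionInCharts.

(** For K = 0 the pair is (t, 1); for K < 0 it is (sinh (k t) / k, cosh (k t)) with k = sqrt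
    (-K). *)
Lemma comparison_pair (R : realType) (K : R) : K <= 0 ->
  exists S C : R -> R,
  [/\ forall t : R, is_derive t 1 S (C t),
      forall t : R, is_derive t 1 C (- K * S t),
      S 0 = 0, C 0 = 1 &
      forall t, 0 < t -> [/\ 0 < S t, 0 < C t & comparison_fun K t = C t / S t]].
Proof.
rewrite le_eqVlt => /orP[/eqP ->|K0].
  exists id, (fun=> 1); split=> //.
  - by move=> t; exact: is_derive_id.
  - by move=> t; rewrite oppr0 mul0r; exact: is_derive_cst.
  - by move=> t t0; split => //; rewrite /comparison_fun ltxx eqxx mul1r.
set k := Num.sqrt (- K).
have k0 : 0 < k by rewrite sqrtr_gt0 oppr_gt0.
have kn0 : k != 0 by rewrite gt_eqF.
have kk : k * k = - K by rewrite -expr2 sqr_sqrtr // oppr_ge0 ltW.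
have dexp (a t : R) : is_derive t 1 (fun s => expR (a * s)) (a * expR (a * t)).
  have dl := is_derive_cmul a (is_derive_id t (1 : R)).
  have de := is_derive_expR (a * t).
  have := derive_comp_real (@ex_derive _ _ _ _ _ _ _ dl) (@ex_derive _ _ _ _ _ _ _ de).
  by rewrite (@derive_val _ _ _ _ _ _ _ dl) (@derive_val _ _ _ _ _ _ _ de) mulr1.
exists (fun t => (2 * k)^-1 * (expR (k * t) - expR (- k * t))),
  (fun t => 2^-1 * (expR (k * t) + expR (- k * t))).
split.
- move=> t; have := is_derive_cmul (2 * k)^-1 (is_deriveB (dexp k t) (dexp (- k) t)).
  by congr (is_derive _ _ _ _); field.
- move=> t; have := is_derive_cmul 2^-1 (is_deriveD (dexp k t) (dexp (- k) t)).
  by congr (is_derive _ _ _ _); rewrite -kk; field.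
- by rewrite !mulr0 subrr mulr0.
- by rewrite !mulr0 expR0; field.
move=> t t0.
have lt_exp : expR (- k * t) < expR (k * t).
  by rewrite ltr_expR mulNr; have := mulr_gt0 k0 t0; lra.
have d0 : expR (k * t) - expR (- k * t) != 0 by rewrite subr_eq0 gt_eqF.
split.
- by rewrite mulr_gt0 ?invr_gt0 ?subr_gt0 // mulr_gt0.
- by rewrite mulr_gt0 ?invr_gt0 // addr_gt0 ?expR_gt0.
rewrite /comparison_fun ltNge (ltW K0) /= lt_eqF // /hyperbolic_cotangent -/k -mulNr.
by field; rewrite ?d0 ?kn0.
Qed.

(** Only earlier times are compared, since the maximum over [0,t] x M may be attained at the final
    time. *)
Lemma derive_ge0_left_max (R : realType) (h : R -> R) (t a dh : R) : a < t ->
  is_derive t 1 h dh -> (forall s, a < s < t -> h s <= h t) -> 0 <= dh.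
Proof.
move=> at0 d hmax; rewrite leNgt; apply/negP => neg.
have dd : s^-1 *: (h (s *: 1 + t) - h t) @[s --> 0^'] --> dh.
  have de := @ex_derive _ _ _ _ _ _ _ d.
  by rewrite -(@derive_val _ _ _ _ _ _ _ d).
have : \forall s \near (0 : R)^', s^-1 *: (h (s *: 1 + t) - h t) < 0.
  exact: (cvgr_lt _ dd _ neg).
move=> /nbhs_ballP[r /= r0 ballr].
pose e := Num.min (r / 2) ((t - a) / 2).
have e0 : 0 < e by rewrite lt_min !divr_gt0 // subr_gt0.
have er : e <= r / 2 by rewrite ge_min lexx.
have ea : e <= (t - a) / 2 by rewrite ge_min lexx orbT.
have := ballr (- e); rewrite /ball /= sub0r opprK gtr0_norm //.
have -> : e < r by lra.
move=> /(_ isT); rewrite oppr_eq0 gt_eqF // => /(_ isT).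
rewrite [(- e) *: 1]mulr1 invrN scaleNr oppr_lt0.
rewrite [_ *: _]mulrC pmulr_lgt0 ?invr_gt0 // subr_gt0 ltNge => /negP; apply.
by apply: hmax; apply/andP; split; lra.
Qed.

(** * The maximum principle on [0,t] x M *)

Section PressureLaplacian.
Variables (R : realType) (n : nat) (M : riemannianManifold R n).
Variables (m : R) (J : set R) (rho : R -> M -> R).
Hypothesis rho_smooth : smooth_evolution J rho.
Hypothesis rho_pos : forall t x, J t -> 0 < rho t x.

Definition pressure_laplacian (p : R * M) : R :=
  m / (m - 1) * laplacian (fun z => rho p.1 z `^ (m - 1)) p.2.

(** Near each point the function coincides with the slice Laplacian of a local extension in one
    chart, but only at times in [J]; hence continuity within [K]. *)
Lemma pressure_laplacian_continuous (K : set (R * M)) :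
  (forall p, K p -> J p.1) -> {within K, continuous pressure_laplacian}.
Proof.
move=> KJ; apply/subspace_continuousP => -[t x] Kp.
have Jt : J t := KJ _ Kp.
have [c ac dx] := atlas_cover x.
have [Q [F [ce Qx]]] := chart_extension_exists rho_smooth rho_pos ac dx Jt.
pose loc (p : R * M) : R * 'rV[R]_n := (p.1, chart_map c p.2).
pose q := slice_laplacian (metric c) (pressure m F) \o loc.
have cx := chart_cod_map dx.
have loc_cont : {for (t, x), continuous loc}.
  have h1 : (fun p : R * M => p.1) @ (t, x) --> t by exact: cvg_fst.
  have h2 : (fun p : R * M => chart_map c p.2) @ (t, x) --> chart_map c x.
    apply: (@continuous_comp _ _ _ (@snd R M) (chart_map c) (t, x)); first exact: cvg_snd.
    exact: chart_map_continuous.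
  exact: (cvg_pair h1 h2).
have q_cont : {for (t, x), continuous q}.
  apply: (@continuous_comp _ _ _ loc _ (t, x) loc_cont).
  exact: (slice_laplacian_continuous (@chart_cod_open _ _ _ c) (metric_on_chart ac)
    (pressure_smooth m (ce_open ce) (ce_smooth ce) (ce_pos ce)) Qx cx).
have e : \forall p \near (t, x), Q (loc p) /\ chart_dom c p.2.
  apply: filterI.
    exact: (loc_cont _ (open_nbhs_nbhs (conj (ce_open ce) Qx))).
  exact: (@cvg_snd _ _ _ (nbhs x) _ _ (open_nbhs_nbhs (conj (@chart_dom_open _ _ _ c) dx))).
have E p : Q (loc p) -> chart_dom c p.2 -> J p.1 -> pressure_laplacian p = q p.
  by move=> Qp dp Jp; exact: (laplacian_pressure m ac ce Jp dp Qp).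
suff : pressure_laplacian @ within K (nbhs (t, x)) --> q (t, x).
  by rewrite -(E (t, x) Qx dx Jt).
have cw : q @ within K (nbhs (t, x)) --> q (t, x).
  exact: (@cvg_within_filter _ _ q (nbhs (t, x)) _ _ K q_cont).
apply: (cvg_trans _ cw).
apply: near_eq_cvg; rewrite /within /=.
by apply: filterS e => p [Qp dp] Kp'; rewrite (E p) //; exact: KJ.
Qed.

End PressureLaplacian.

Theorem theorem6p1 (R : realType) (n : nat) (M : riemannianManifold R n)
    (m k3 : R) (U : M -> R) (J : set R) (rho : R -> M -> R)
    (n_gt0 : (0 < n)%N)
    (M_compact : compact [set: M])
    (M_ricci : nonnegative_ricci M)
    (m_gt0 : 0 < m) (m_neq1 : m != 1) (m_n : 0 < m - 1 + 2 / n%:R)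
    (U_smooth : smooth_function U)
    (U_lap : forall x, k3 / (2 * m) <= laplacian U x)
    (J_interval : is_interval J) (J_start : J 0)
    (J_ge0 : forall t, J t -> 0 <= t)
    (rho_smooth : smooth_evolution J rho)
    (rho_pos : forall t x, J t -> 0 < rho t x)
    (rho_eq : solves_equation J m U rho) :
  forall t x, J t -> 0 < t ->
    2 * m / (1 - m) * laplacian (fun y => rho t y `^ (m - 1)) x <=
    2 * n%:R / (2 + n%:R * (m - 1)) *
      comparison_fun (k3 * (2 + n%:R * (m - 1)) / (2 * n%:R)) t.
Proof.
move=> t1 x1 Jt1 t1_gt0.
have n0 : 0 < n%:R :> R by rewrite ltr0n.
have nn0 : n%:R != 0 :> R by rewrite gt_eqF.
set beta := m - 1 + 2 / n%:R in m_n.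
have bE : 2 + n%:R * (m - 1) = n%:R * beta by rewrite /beta; field.
have k3_le0 : k3 <= 0.
  have [z zle] := laplacian_le0_somewhere M_compact x1 U_smooth.
  have := le_trans (U_lap z) zle.
  by rewrite pmulr_lle0 // invr_gt0 mulr_gt0.
rewrite bE; set K := k3 * _ / _.
have KE : K = k3 * beta / 2 by rewrite /K; field.
have K_le0 : K <= 0 by rewrite KE pmulr_lle0 ?invr_gt0 // pmulr_lle0.
have [S [C [dS dC S0 C0 SC]]] := comparison_pair K_le0.
have b_neq0 : beta != 0 by rewrite gt_eqF.
have -> : 2 * n%:R / (n%:R * beta) = 2 / beta by field; rewrite b_neq0.
pose W := pressure_laplacian m rho.
have WE t x : 2 * m / (1 - m) * laplacian (fun y => rho t y `^ (m - 1)) x = - 2 * W (t, x).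
  rewrite /W /pressure_laplacian /=; field.
  by rewrite subr_eq0 m_neq1 subr_eq0 eq_sym m_neq1.
pose H (p : R * M) : R := S p.1 * (- 2 * W p) - 2 / beta * C p.1.
pose D : set (R * M) := `[0, t1]%classic `*` [set: M].
have DJ p : D p -> J p.1.
  move=> [/= + _]; rewrite in_itv /= => p01; exact: (J_interval 0 t1).
have H_cont : {within D, continuous H}.
  have cW : {within D, continuous W}.
    exact: (pressure_laplacian_continuous rho_smooth rho_pos DJ).
  have c1 (f df : R -> R) : (forall t : R, is_derive t 1 f (df t)) ->
      {within D, continuous (fun p : R * M => f p.1)}.
    move=> fd; apply: continuous_subspaceT => p.
    apply: (@continuous_comp _ _ _ (@fst R M) f p); first exact: cvg_fst.
    have /derivable1_diffP : derivable f p.1 1 by exact: (@ex_derive _ _ _ _ _ _ _ (fd p.1)).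
    exact: differentiable_continuous.
  apply/subspace_continuousP => p Dp.
  have at_p (f : R * M -> R) : {within D, continuous f} -> f @ within D (nbhs p) --> f p.
    by move=> /subspace_continuousP; apply.
  exact: (cvgB (cvgM (at_p _ (c1 _ _ dS)) (cvgM (cvg_cst _) (at_p _ cW)))
    (cvgM (cvg_cst _) (at_p _ (c1 _ _ dC)))).
have [[t0 x0] D0 H_max] : exists2 p, p \in D & forall q, q \in D -> H q <= H p.
  apply: compact_EVT_max => //.
    by exists (0, x1); split => //=; rewrite in_itv /= lexx ltW.
  by apply: compact_setX => //; exact: segment_compact.
have {D0} [t0_ge0 t0_le] : 0 <= t0 /\ t0 <= t1.
  by move: D0; rewrite inE => -[/= + _]; rewrite in_itv /= => /andP.
have Jt0 : J t0 by apply: (J_interval 0 t1) => //; rewrite t0_ge0.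
have {}H_max t x : 0 <= t <= t1 -> H (t, x) <= H (t0, x0).
  by move=> tI; apply: H_max; rewrite inE; split => //=; rewrite in_itv.
suff H_le0 : H (t0, x0) <= 0.
  have [S1 C1 ->] := SC t1 t1_gt0.
  have : H (t1, x1) <= 0 by apply: le_trans H_le0; apply: H_max; rewrite lexx ltW.
  rewrite /H /= WE subr_le0 => h.
  by rewrite [leRHS]mulrA ler_pdivlMr // mulrC.
rewrite leNgt; apply/negP => H_gt0.
(* At time 0 the value of [H] is - 2 / beta, which is negative. *)
have t0_gt0 : 0 < t0.
  rewrite lt_neqAle t0_ge0 andbT; apply/eqP => t00; move: H_gt0.
  rewrite /H /= -t00 S0 C0 mul0r sub0r mulr1 oppr_gt0.
  by rewrite ltNge divr_ge0 // ltW.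
have [St Ct _] := SC t0 t0_gt0.
have [c ac dx] := atlas_cover x0.
have [Q [F [ce Qx]]] := chart_extension_exists rho_smooth rho_pos ac dx Jt0.
set y0 := chart_map c x0 in Qx.
have oB := open_space_slice t0 (ce_open ce).
pose B := Region oB Qx.
have mB : metric_on (reg_set B) (metric c).
  by apply: metric_on_subset (metric_on_chart ac) => y /(ce_cod ce).
have BQ y : reg_set B y -> [/\ Q (t0, y), chart_dom c (chart_inv c y) &
    chart_map c (chart_inv c y) = y].
  by move=> By; have [] := chart_invK (ce_cod ce By).
have WQ t x : J t -> chart_dom c x -> Q (t, chart_map c x) ->
    W (t, x) = slice_laplacian (metric c) (pressure m F) (t, chart_map c x).
  by move=> Jt dx' Qt; exact: (laplacian_pressure m ac ce Jt dx' Qt).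
have evol : beta * W (t0, x0) ^+ 2 + k3 / 2 <=
    slice_laplacian (metric c) ('D_((1, 0) : R * 'rV[R]_n) (pressure m F)) (t0, y0).
  rewrite (WQ _ _ Jt0 dx Qx).
  have ric y (v : 'rV[R]_n) : reg_set B y -> 0 <= (v *m ricci (metric c) y *m v^T) 0 0.
    by move=> By; apply: M_ricci ac _; exact: (ce_cod ce By).
  have sU : smooth_on (reg_set B) (U \o chart_inv c).
    have sUc : smooth_on (chart_cod c) (U \o chart_inv c) := U_smooth c ac.
    exact (@smooth_on_subset R _ _ (chart_cod c) (reg_set B) _ (fun y By => ce_cod ce By) sUc).
  have F_eq y : reg_set B y -> 'D_((1, 0) : R * 'rV[R]_n) F (t0, y) =
      local_laplacian (metric c) (fun z => F (t0, z) `^ m) y +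
      (U \o chart_inv c) y * F (t0, y) `^ (2 - m).
    move=> By; have [Qy dy yE] := BQ y By.
    have Qy' : Q (t0, chart_map c (chart_inv c y)) by rewrite yE.
    have := derive_time_extension ce J_interval J_start t0_gt0 Jt0 Qy' dy
      (rho_eq t0 (chart_inv c y) Jt0).
    by rewrite (laplacian_powR ac ce m Jt0 dy Qy') yE (ce_rho ce Qy Jt0).
  have Ulap : k3 / (2 * m) <= local_laplacian (metric c) (U \o chart_inv c) y0.
    have cx := chart_cod_map dx.
    rewrite -(laplacian_chart ac dx (@chart_cod_open _ _ _ c) (@subset_refl _ _) cx
      (@U_smooth c ac)).
    exact: U_lap.
  (* At the fixed time t0 the factor -2 S(t0) is negative, so a maximum of [H] in space is a minimum
     of [W]. *)
  have W_min y : reg_set B y -> slice_laplacian (metric c) (pressure m F) (t0, y0) <=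
      slice_laplacian (metric c) (pressure m F) (t0, y).
    move=> By; have [Qy dy yE] := BQ y By.
    have := H_max t0 (chart_inv c y); rewrite t0_ge0 t0_le => /(_ isT).
    rewrite /H /= lerD2r ler_pM2l // ler_nM2l; last by lra.
    by rewrite (WQ _ _ Jt0 dx Qx) (WQ _ _ Jt0 dy) yE.
  exact (pressure_evolution (D := B) mB m_neq1 m_gt0 (ce_open ce) (ce_smooth ce)
    (ce_pos ce) n_gt0 ric sU (fun y By => By) F_eq Qx Ulap W_min).
have sP := pressure_smooth m (ce_open ce) (ce_smooth ce) (ce_pos ce).
have dL := is_derive_slice_laplacian (metric c) (ce_open ce) sP Qx.
pose L (s : R) : R := slice_laplacian (metric c) (pressure m F) (s, y0).
pose L' := slice_laplacian (metric c) ('D_((1, 0) : R * 'rV[R]_n) (pressure m F)) (t0, y0).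
have dh := is_deriveB (is_deriveM (dS t0) (is_derive_cmul (- 2) dL))
  (is_derive_cmul (2 / beta) (dC t0)).
have [r r0 Qr] : exists2 r : R, 0 < r & forall s : R, `|t0 - s| < r -> Q (s, y0).
  have /nbhs_ballP[r /= r0 ballr] : \forall s \near t0, Q (s, y0).
    exact (@pair_l_continuous R 'rV[R]_n y0 t0 Q (open_nbhs_nbhs (conj (ce_open ce) Qx))).
  by exists r.
have h_ge0 : 0 <= S t0 * (- 2 * L') + - 2 * L t0 * C t0 - 2 / beta * (- K * S t0).
  (* The lower end keeps the earlier times positive and inside the domain of [F]. *)
  apply: (@derive_ge0_left_max _ _ t0 (Num.max 0 (t0 - r)) _ _ dh).
    by rewrite gt_max t0_gt0 /=; lra.
  move=> s; rewrite gt_max => /andP[/andP[s0 sr] st].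
  have Qs : Q (s, y0) by apply: Qr; rewrite ger0_norm; lra.
  have Js : J s by apply: (J_interval 0 t0) => //; rewrite !ltW.
  have := H_max s x0; rewrite ltW //= (le_trans (ltW st)) // => /(_ isT).
  by rewrite /H /= !WQ.
have LW : L t0 = W (t0, x0) by rewrite WQ.
move: evol h_ge0 H_gt0; rewrite -/L' -LW /H /= -LW KE.
move: (L t0) L' (S t0) (C t0) St Ct => l l' s e s0 e0 evol h_ge0 H_gt0.
have b0 : 0 < 2 / beta by rewrite divr_gt0.
have h : 0 <= s * (- 2 * l') - 2 * l * e + k3 * s.
  by apply: le_trans h_ge0 _; rewrite le_eqVlt; apply/orP; left; apply/eqP; field.
have l_lt0 : l < 0.
  have e2 := mulr_gt0 b0 e0; rewrite ltNge; apply/negP => l0.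
  have := mulr_ge0 (ltW s0) l0; lra.
(* This quantity is - beta / 2 times the value of [H] at the maximum. *)
have bsl : beta * (s * l) + e < 0.
  have : beta / 2 * (s * (- 2 * l) - 2 / beta * e) = - (beta * (s * l) + e) by field.
  have : 0 < beta / 2 * (s * (- 2 * l) - 2 / beta * e) by rewrite mulr_gt0 // divr_gt0.
  lra.
(* Inserting the evolution inequality into [h] cancels the two k3 terms and leaves 0 <= -2 l (beta s
   l + e), whereas the product of the two negative factors is positive. *)
have := ler_wpM2l (ltW s0) evol.
have : 0 < l * (beta * (s * l) + e) by rewrite nmulr_rgt0.
rewrite expr2; nra.
Qed.
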